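(* The universal interpolation property and the universal approximation property are not equivalent for control systems in general. Concretely, (1) there exists a control system that possesses the exact universal interpolation property, but does not possess the universal approximation property (in $L^p$ sense); (2) there exists a control system that possesses the universal approximation property (in $L^p$ sense), but does not possess the exact universal interpolation property.
   Context: Consider control systems $\dot x(t)=f(x(t);\theta(t))$, $x(0)=x_0$, on $\mathbb R^d$ with $d\ge 2$, where the control $\theta(t)$ takes values in a fixed set $\Theta\subseteq\mathbb R^l$ and is piecewise constant in time, and $x\mapsto f(x;\theta)$ is (at least locally) Lipschitz for each $\theta$. The control family is $\mathcal F=\{x\mapsto f(x;\theta)\mid\theta\in\Theta\}$. For $g\in\mathcal F$, $\varphi^g_t$ denotes the flow map $x_0\mapsto x(t)$ of $\dot x=g(x)$. The attainable set $\mathcal A_{\mathcal F}$ is the set of all finite compositions $\varphi^{f_k}_{t_k}\circ\cdots\circ\varphi^{f_1}_{t_1}$ with $f_i\in\mathcal F$, $t_i\ge 0$, $k\ge1$ (for locally Lipschitz families, restricted to times for which the flows exist on the relevant compact set). The system has the exact universal interpolation property if for any positive integer $N$ and any data $(x_1,y_1),\dots,(x_N,y_N)$ in $\mathbb R^d\times\mathbb R^d$ with $x_i\ne x_j$ and $y_i\ne y_j$ for $i\ne j$, there exists $\varphi\in\mathcal A_{\mathcal F}$ with $\varphi(x_i)=y_i$ for all $i$. The system has the universal approximation property in $L^p$ sense ($1\le p<\infty$) if for any continuous $F:\mathbb R^d\to\mathbb R^d$, compact $K\subseteq\mathbb R^d$ and $\varepsilon>0$ there exists $\varphi\in\mathcal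 A_{\mathcal F}$ with $\|F-\varphi\|_{L^p(K)}<\varepsilon$. *)

(* Defs.v *)
From HB Require Import structures.
From mathcomp Require Import all_boot all_order all_algebra.
From mathcomp Require Import all_classical all_reals all_analysis.
Set Implicit Arguments. Unset Strict Implicit. Unset Printing Implicit Defensive.
Import Order.TTheory GRing.Theory Num.Theory numFieldNormedType.Exports.
Local Open Scope classical_set_scope.
Local Open Scope ring_scope.

Section Defs.
Variable R : realType.

Definition eucl_norm (d : nat) (v : 'rV[R]_d) : R :=
  Num.sqrt (\sum_(i < d) (v 0 i) ^+ 2).

(** Local Lipschitz continuity of a vector field g : R^d -> R^d
    (the norm used is MathComp's max-norm; all norms on R^d are equivalent). *)
Definition locally_lipschitz (d : nat) (g : 'rV[R]_d -> 'rV[R]_d) : Prop :=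
  forall x : 'rV[R]_d, exists2 r : R, 0 < r &
    exists L : R, forall a b, ball x r a -> ball x r b ->
      `|g a - g b| <= L * `|a - b|.

(** [flow_on g t S phi]: t >= 0 and, for every x in S, the solution of
    y' = g(y), y(0) = x exists on [0,t] and phi x = y(t).
    (For locally Lipschitz g the solution is unique, so phi is the time-t
    flow map varphi^g_t restricted to S.) *)
Definition flow_on (d : nat) (g : 'rV[R]_d -> 'rV[R]_d) (t : R)
    (S : set 'rV[R]_d) (phi : 'rV[R]_d -> 'rV[R]_d) : Prop :=
  0 <= t /\
  forall x, S x -> exists y : R -> 'rV[R]_d,
    [/\ y 0 = x,
        {within `[0, t], continuous y},
        (forall s, 0 < s < t -> is_derive s (1 : R) y (g (y s)))
      & phi x = y t].

(** Attainable maps on a set S: finite compositions (k >= 1) of flow maps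
    of fields in the family Fam, each flow required to exist on the image
    of S under the previous maps. The map is only constrained on S. *)
Inductive attainable_on (d : nat) (Fam : set ('rV[R]_d -> 'rV[R]_d))
  : set 'rV[R]_d -> ('rV[R]_d -> 'rV[R]_d) -> Prop :=
| att_flow g t S phi :
    Fam g -> flow_on g t S phi -> attainable_on Fam S phi
| att_comp g t S phi psi :
    attainable_on Fam S phi -> Fam g -> flow_on g t (phi @` S) psi ->
    attainable_on Fam S (psi \o phi).

Definition control_family (d l : nat) (Theta : set 'rV[R]_l)
    (f : 'rV[R]_d -> 'rV[R]_l -> 'rV[R]_d) : set ('rV[R]_d -> 'rV[R]_d) :=
  (fun theta x => f x theta) @` Theta.

Definition control_system (d l : nat) (Theta : set 'rV[R]_l)
    (f : 'rV[R]_d -> 'rV[R]_l -> 'rV[R]_d) : Prop :=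
  forall theta, Theta theta -> locally_lipschitz (fun x => f x theta).

(** Lebesgue integral on R^d of a nonnegative function, as the iterated
    one-dimensional Lebesgue integral (Tonelli). *)
Definition set_coord (d : nat) (v : 'rV[R]_d) (k : nat) (t : R) : 'rV[R]_d :=
  \row_j (if (j : nat) == k then t else v 0 j).

Fixpoint iter_integral (d k : nat) (h : 'rV[R]_d -> \bar R) (v : 'rV[R]_d)
  : \bar R :=
  match k with
  | 0 => h v
  | k.+1 => (\int[@lebesgue_measure R]_t iter_integral k h (set_coord v k t))%E
  end.

Definition integral_Rd (d : nat) (h : 'rV[R]_d -> \bar R) : \bar R :=
  iter_integral d h 0.

Definition Lp_dist (d : nat) (p : R) (K : set 'rV[R]_d)
    (F phi : 'rV[R]_d -> 'rV[R]_d) : \bar R :=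
  ((integral_Rd (fun x => ((\1_K x : R) * (eucl_norm (F x - phi x)) `^ p)%:E))
     `^ p^-1)%E.

Definition exact_universal_interpolation (d : nat)
    (Fam : set ('rV[R]_d -> 'rV[R]_d)) : Prop :=
  forall (N : nat) (xs ys : 'I_N -> 'rV[R]_d),
    injective xs -> injective ys ->
    exists phi, attainable_on Fam (range xs) phi /\
                forall i, phi (xs i) = ys i.

Definition universal_approximation_Lp (d : nat) (p : R)
    (Fam : set ('rV[R]_d -> 'rV[R]_d)) : Prop :=
  forall F : 'rV[R]_d -> 'rV[R]_d, continuous F ->
  forall K : set 'rV[R]_d, compact K ->
  forall eps : R, 0 < eps ->
    exists phi, attainable_on Fam K phi /\ (Lp_dist p K F phi < eps%:E)%E.

End Defs.

(* Main.v *)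
Require Import Defs.
From HB Require Import structures.
From mathcomp Require Import all_boot all_order all_algebra.
From mathcomp Require Import all_classical all_reals all_analysis.
From mathcomp Require Import measurable_realfun ring lra zify.
Import Order.TTheory GRing.Theory Num.Theory numFieldNormedType.Exports.
Local Open Scope classical_set_scope.
Local Open Scope ring_scope.

(** Both systems are built from shears [x' = a(u . x) w] with [u . w = 0], whose flow
    is [x + t a(u . x) w].  Linear shears and shears with tent profiles move any finite
    set of distinct points to any other one: a generic linear shear makes the first
    coordinates distinct, after which tents adjust the other coordinates point by point.

    (1) Shears along a coordinate axis preserve Lebesgue measure, so no composition of
    them can be [L^p]-close to the constant map [0] on a cube.

    (2) Keep only the shears that vanish at the origin and add, for every mesh [h], the
    field that moves each coordinate away from [0] by a logistic equation inside each
    cell of the grid [h Z].  As time tends to infinity its flow converges everywhere to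
    rounding onto the grid; composing with a shear map that interpolates the target at
    the finitely many relevant nonzero grid points yields [L^p] approximation.  All the
    fields vanish at the origin, which is therefore fixed by every attainable map. *)

Set Implicit Arguments.
Unset Strict Implicit.
Unset Printing Implicit Defensive.

(** * Iterated integrals *)

Section IteratedIntegral.
Context {R : realType} {d : nat}.
Implicit Types (u x v : 'rV[R]_d) (h g : 'rV[R]_d -> \bar R) (s : seq nat).
Local Notation mu := (@lebesgue_measure R).

Definition measurable_coords d' (T : measurableType d') (u : T -> 'rV[R]_d) :=
  forall i, measurable_fun [set: T] (fun t => u t 0 i : measurableTypeR R).

(* Measurability on R^d, tested along all coordinatewise measurable maps
   because the type of row vectors carries no sigma-algebra. *)
Definition test_measurable h := forall d' (T : measurableType d') (u : T -> 'rV[R]_d),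
  measurable_coords u -> measurable_fun [set: T] (fun t => h (u t)).

Definition preserves_measurable (phi : 'rV[R]_d -> 'rV[R]_d) :=
  forall d' (T : measurableType d') (u : T -> 'rV[R]_d),
  measurable_coords u -> measurable_coords (phi \o u).

Lemma test_measurable_comp h phi :
  test_measurable h -> preserves_measurable phi -> test_measurable (h \o phi).
Proof. by move=> mh mphi d' T u /mphi/mh. Qed.

Lemma measurable_coords_set_coord d' (T : measurableType d') (u : T -> 'rV[R]_d)
    (k : nat) (a : T -> R) :
  measurable_coords u -> measurable_fun [set: T] (a : T -> measurableTypeR R) ->
  measurable_coords (fun t => set_coord (u t) k (a t)).
Proof.
move=> mu_ ma i; rewrite /set_coord; under eq_fun do rewrite mxE.
by case: (eqVneq (i : nat) k) => _; [exact: ma|exact: mu_].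
Qed.

Fixpoint seq_integral s h v : \bar R :=
  if s is k :: s' then (\int[mu]_t seq_integral s' h (set_coord v k t))%E
  else h v.

Lemma seq_integral_cat s1 s2 h v :
  seq_integral (s1 ++ s2) h v = seq_integral s1 (seq_integral s2 h) v.
Proof. by elim: s1 v => //= k s1 IH v; apply: eq_integral => t _; exact: IH. Qed.

Lemma iter_integralE k h v : iter_integral k h v = seq_integral (rev (iota 0 k)) h v.
Proof.
elim: k v => [//|k IH v]; rewrite -{2}addn1 iotaD rev_cat /=.
by apply: eq_integral => t _; rewrite IH.
Qed.

Lemma seq_integral_ge0 s h v : (forall x, 0 <= h x)%E -> (0 <= seq_integral s h v)%E.
Proof. by move=> h0; elim: s v => //= k s IH v; apply: integral_ge0. Qed.

Lemma eq_seq_integral s h g v : (forall x, h x = g x) ->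
  seq_integral s h v = seq_integral s g v.
Proof. by move=> /funext->. Qed.

Lemma test_measurable_section h v k : test_measurable h ->
  measurable_fun [set: measurableTypeR R] (fun t => h (set_coord v k t)).
Proof.
move=> mh; apply: (mh _ _ (set_coord v k)).
by apply: measurable_coords_set_coord => // i; exact: measurable_cst.
Qed.

Lemma test_measurable_seq_integral s h : (forall x, 0 <= h x)%E ->
  test_measurable h -> test_measurable (seq_integral s h).
Proof.
move=> h0 mh; elim: s => //= k s IH d' T u mcu.
pose F (z : T * measurableTypeR R) := seq_integral s h (set_coord (u z.1) k z.2).
apply: (@measurable_fun_fubini_tonelli_F _ _ _ _ _ mu F).
- apply: (IH _ _ (fun z : T * measurableTypeR R => set_coord (u z.1) k z.2)).
  apply: measurable_coords_set_coord; last exact: measurable_snd.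
  by move=> i; apply: (measurableT_comp (mcu i)); exact: measurable_fst.
- by move=> z; exact: seq_integral_ge0.
Qed.

Lemma set_coordC v (j k : nat) (a b : R) : j != k ->
  set_coord (set_coord v k a) j b = set_coord (set_coord v j b) k a.
Proof.
move=> jk; apply/rowP => i; rewrite !mxE; case: (eqVneq (i : nat) j) => [->|//].
by rewrite (negbTE jk).
Qed.

Lemma seq_integral_swap j k s h v : (forall x, 0 <= h x)%E -> test_measurable h ->
  j != k -> seq_integral [:: j, k & s] h v = seq_integral [:: k, j & s] h v.
Proof.
move=> h0 mh jk /=.
pose F (z : measurableTypeR R * measurableTypeR R) :=
  seq_integral s h (set_coord (set_coord v j z.1) k z.2).
rewrite (@fubini_tonelli _ _ _ _ _ mu mu F).
- apply: eq_integral => b _; apply: eq_integral => a _.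
  by rewrite /F /= set_coordC// eq_sym.
- apply: (test_measurable_seq_integral s h0 mh
    (u := fun z : measurableTypeR R * measurableTypeR R =>
      set_coord (set_coord v j z.1) k z.2)).
  apply: measurable_coords_set_coord; last exact: measurable_snd.
  apply: measurable_coords_set_coord; last exact: measurable_fst.
  by move=> i; exact: measurable_cst.
- by move=> z; exact: seq_integral_ge0.
Qed.

Lemma seq_integral_rcons k s h v : (forall x, 0 <= h x)%E -> test_measurable h ->
  k \notin s -> seq_integral (k :: s) h v = seq_integral (rcons s k) h v.
Proof.
move=> h0 mh; elim: s v => // j s IH v; rewrite inE negb_or => /andP[kj ks].
rewrite seq_integral_swap//= ; apply: eq_integral => t _; exact: IH.
Qed.

Lemma seq_integral_le s h g v : (forall x, 0 <= h x)%E -> (forall x, h x <= g x)%E ->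
  test_measurable h -> test_measurable g ->
  (seq_integral s h v <= seq_integral s g v)%E.
Proof.
move=> h0 hg mh mg; elim: s v => //= k s IH v.
have g0 x : (0 <= g x)%E by exact: le_trans (hg x).
apply: ge0_le_integral => //; try by move=> t _; exact: seq_integral_ge0.
- by apply: test_measurable_section; exact: test_measurable_seq_integral.
- by apply: test_measurable_section; exact: test_measurable_seq_integral.
Qed.

Lemma seq_integralD s h g v : (forall x, 0 <= h x)%E -> (forall x, 0 <= g x)%E ->
  test_measurable h -> test_measurable g ->
  seq_integral s (fun x => h x + g x)%E v = (seq_integral s h v + seq_integral s g v)%E.
Proof.
move=> h0 g0 mh mg; elim: s v => //= k s IH v.
rewrite -ge0_integralD//.
- by apply: eq_integral => t _; rewrite IH.
- by move=> t _; exact: seq_integral_ge0.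
- by apply: test_measurable_section; exact: test_measurable_seq_integral.
- by move=> t _; exact: seq_integral_ge0.
- by apply: test_measurable_section; exact: test_measurable_seq_integral.
Qed.

Lemma seq_integralZ s (c : R) h v : 0 <= c -> (forall x, 0 <= h x)%E ->
  test_measurable h ->
  seq_integral s (fun x => c%:E * h x)%E v = (c%:E * seq_integral s h v)%E.
Proof.
move=> c0 h0 mh; elim: s v => //= k s IH v.
rewrite -ge0_integralZl//.
- by apply: eq_integral => t _; rewrite IH.
- by apply: test_measurable_section; exact: test_measurable_seq_integral.
- by move=> t _; exact: seq_integral_ge0.
Qed.

End IteratedIntegral.

Section Translation.
Context {R : realType}.
Local Notation mu := (@lebesgue_measure R).

Lemma lebesgue_integral_translation (f : R -> \bar R) (c : R) :
  measurable_fun [set: measurableTypeR R] f -> (forall x, 0 <= f x)%E ->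
  (\int[mu]_t f (t + c)%R = \int[mu]_t f t)%E.
Proof.
move=> mf f0.
have mt : measurable_fun [set: measurableTypeR R] (fun t => t + c : measurableTypeR R).
  exact: measurable_funD.
pose nu := pushforward mu (fun t : measurableTypeR R => t + c : measurableTypeR R).
have nuE X : measurable X -> mu X = nu X.
  apply: lebesgue_measure_unique => _ [[a b] _ <-] /=.
  rewrite /pushforward.
  have -> : (fun t => t + c) @^-1` `]a, b]%classic = `]a - c, b - c]%classic.
    by apply/seteqP; split => t /=; rewrite !in_itv/= ltrBlDr lerBrDr.
  rewrite !lebesgue_measure_itv /= !lte_fin ltrD2r; case: ifP => // _.
  by rewrite -!EFinB opprB addrA subrK.
transitivity (\int[nu]_t f t)%E.
  rewrite ge0_integral_pushforward ?preimage_setT//.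
apply: eq_measure_integral => A mA _; exact/esym/nuE.
Qed.

End Translation.

Section ShearInvariance.
Context {R : realType} {d : nat}.
Implicit Types (u x v : 'rV[R]_d) (h g : 'rV[R]_d -> \bar R) (s : seq nat).

Lemma seq_integral_innermost s (k : nat) : uniq s -> k \in s ->
  exists s', forall h v, (forall x, 0 <= h x)%E -> test_measurable h ->
    seq_integral s h v = seq_integral s' (seq_integral [:: k] h) v.
Proof.
move=> us ks; case/splitPr: ks us => s1 s2; rewrite cat_uniq => /and3P[_ _ /andP[ks2 _]].
exists (s1 ++ s2) => h v h0 mh; rewrite seq_integral_cat seq_integral_cat.
apply: eq_seq_integral => w.
by rewrite seq_integral_rcons// -cats1 seq_integral_cat.
Qed.

Lemma integral_Rd_shear (i : 'I_d) (a : 'rV[R]_d -> R) h :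
  (forall x t, a (set_coord x i t) = a x) -> (forall x, 0 <= h x)%E ->
  test_measurable h ->
  preserves_measurable (fun x => x + a x *: delta_mx 0 i) ->
  integral_Rd (fun x => h (x + a x *: delta_mx 0 i)) = integral_Rd h.
Proof.
move=> ai h0 mh mphi; rewrite /integral_Rd !iter_integralE.
have id : (i : nat) \in rev (iota 0 d) by rewrite mem_rev mem_iota /= add0n.
have [|s' E] := seq_integral_innermost _ id; first by rewrite rev_uniq iota_uniq.
rewrite !E//; last exact: (test_measurable_comp mh mphi).
apply: eq_seq_integral => w /=.
rewrite -[RHS](lebesgue_integral_translation (a w))//; last first.
  exact: test_measurable_section.
apply: eq_integral => t _; congr h.
apply/rowP => j; rewrite !mxE ai /=; case: (eqVneq (j : nat) i) => [/val_inj->|ji].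
  by rewrite eqxx mulr1.
by rewrite (_ : (j == i) = false) ?mulr0 ?addr0//; apply: contraNF ji => /eqP->.
Qed.

End ShearInvariance.

Section ContinuousTestMeasurable.
Context {R : realType} {d : nat}.
Implicit Types (x v : 'rV[R]_d).

Lemma ball_rowP x (e : R) v : ball x e v <-> 0 < e /\ forall j, `|x 0 j - v 0 j| < e.
Proof.
split=> -[e0 xv]; split=> //; first by move=> j; have := xv 0 j; rewrite -ball_normE.
by move=> i j; rewrite (ord1 i) -ball_normE; exact: xv.
Qed.

Lemma measurable_preimage_open d' (T : measurableType d') (u : T -> 'rV[R]_d)
    (U : set 'rV[R]_d) :
  measurable_coords u -> open U -> measurable (u @^-1` U).
Proof.
move=> mu oU.
pose B (cn : 'rV[rat]_d * nat) : set 'rV[R]_d :=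
  ball (map_mx ratr cn.1 : 'rV[R]_d) cn.2.+1%:R^-1.
have UE : U = \bigcup_cn (if `[< B cn `<=` U >] then B cn else set0).
  apply/seteqP; split=> [x Ux|x [cn _]]; last by case: asboolP => // BU /BU.
  have /nbhs_ballP[e /= e0 eU] : nbhs x U by apply: open_nbhs_nbhs.
  have [n nlt] := ltr_add_invr (divr_gt0 e0 (ltr0n R 2)).
  rewrite add0r in nlt.
  set r : R := n.+1%:R^-1 in nlt.
  have r0 : 0 < r by rewrite invr_gt0.
  have /choice[q qP] : forall j, exists q : rat, `|ratr q - x 0 j| < r.
    move=> j; have [|q] := @rat_in_itvoo R (x 0 j - r) (x 0 j + r).
      by rewrite ltrD2l gtrN.
    by rewrite in_itv /= => qx; exists q; rewrite ltr_distl.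
  have xB : B (\row_j q j, n) x.
    by apply/ball_rowP; split=> // j; rewrite !mxE.
  exists (\row_j q j, n) => //; rewrite asboolT// => y By; apply: eU.
  rewrite (splitr e).
  apply: (@ball_triangle _ _ (map_mx ratr (\row_j q j : 'rV[rat]_d) : 'rV[R]_d)).
    by apply: ball_sym; apply: le_ball xB; exact: ltW.
  by apply: le_ball By; exact: ltW.
rewrite UE preimage_bigcup; apply: countable_bigcupT_measurable => [|[c n]].
  exact: countableP.
case: asboolP => _; last by rewrite preimage_set0.
have -> : u @^-1` B (c, n) =
    \bigcap_(j in [set: 'I_d]) ((fun t => u t 0 j) @^-1`
      `]ratr (c 0 j) - n.+1%:R^-1, ratr (c 0 j) + n.+1%:R^-1[%classic).
  apply/seteqP; split=> t /=.
    move=> /ball_rowP[_ Bt] j _; have := Bt j.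
    by rewrite /= mxE in_itv /= distrC ltr_distl.
  move=> Bt; apply/ball_rowP; split=> [|j]; first by rewrite invr_gt0.
  by have := Bt j I; rewrite /= mxE in_itv /= distrC ltr_distl.
apply: fin_bigcap_measurable => // j _.
by rewrite -[X in measurable X]setTI; apply: (mu j).
Qed.

Lemma measurable_comp_continuous d' (T : measurableType d') (u : T -> 'rV[R]_d)
    (f : 'rV[R]_d -> R) :
  measurable_coords u -> continuous f ->
  measurable_fun [set: T] (fun t => f (u t) : measurableTypeR R).
Proof.
move=> mu cf; apply: (measurability _ (RGenOpens.measurableE R)).
move=> _ [_ [a [b ->]] <-]; rewrite setTI.
apply: (measurable_preimage_open (U := f @^-1` `]a, b[%classic) mu).
by apply: open_comp => // x _; exact: cf.
Qed.

Lemma preserves_measurable_continuous (phi : 'rV[R]_d -> 'rV[R]_d) :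
  continuous phi -> preserves_measurable phi.
Proof.
move=> cphi d' T u mu i.
apply: (measurable_comp_continuous (f := fun x => phi x 0 i)) => // x.
apply: (@continuous_comp _ _ _ phi (fun M : 'rV[R]_d => M 0 i) x (cphi x)).
exact: coord_continuous.
Qed.

Lemma measurable_indic_closed d' (T : measurableType d') (u : T -> 'rV[R]_d)
    (K : set 'rV[R]_d) : measurable_coords u -> closed K ->
  measurable_fun [set: T] (fun t => \1_K (u t) : measurableTypeR R).
Proof.
move=> mu cK.
have -> : (fun t => \1_K (u t)) = \1_(u @^-1` K) :> (T -> R).
  by apply/funext => t; rewrite !indicE /=; congr (_ %:R); apply/idP/idP; rewrite !inE.
apply: measurable_indic; rewrite -[K]setCK preimage_setC; apply: measurableC.
exact: (measurable_preimage_open mu (closed_openC cK)).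
Qed.

Lemma test_measurable_Lp_integrand (p : R) (K : set 'rV[R]_d) (F phi : 'rV[R]_d -> 'rV[R]_d) :
  closed K -> continuous F -> preserves_measurable phi ->
  test_measurable (fun x => ((\1_K x : R) * eucl_norm (F x - phi x) `^ p)%:E).
Proof.
move=> cK cF mphi d' T u mu; apply/measurable_EFinP.
apply: measurable_funM.
  exact: measurable_indic_closed.
apply: (measurableT_comp (measurable_powR p)).
have msqrt : measurable_fun [set: measurableTypeR R] (Num.sqrt : R -> measurableTypeR R).
  by apply: continuous_measurable_fun; exact: sqrt_continuous.
apply: (measurableT_comp msqrt).
have mG i : measurable_fun [set: T] (fun t => (F (u t) - phi (u t)) 0 i : measurableTypeR R).
  under eq_fun do rewrite !mxE.
  apply: measurable_funB; first exact: (preserves_measurable_continuous cF mu).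
  exact: (mphi _ _ u mu i).
by apply: measurable_sum => i; apply: measurable_funX; exact: mG.
Qed.

End ContinuousTestMeasurable.

Section Boxes.
Context {R : realType} {d : nat}.
Implicit Types (x v : 'rV[R]_d) (h g : 'rV[R]_d -> \bar R).
Local Notation mu := (@lebesgue_measure R).

Definition box (B : R) : set 'rV[R]_d := [set x | forall j, `|x 0 j| <= B].

Definition box_step (B c : R) (k : nat) x : \bar R :=
  (if [forall j : 'I_d, (k <= j)%N ==> (`|x 0 j| <= B)] then c * (2 * B) ^+ k else 0)%:E.

Lemma compact_box B : compact (box B).
Proof.
have -> : box B = [set x | forall j, `[- B, B]%classic (x ord0 j)].
  by apply/seteqP; split=> x Bx j; have := Bx j; rewrite /= in_itv /= ler_norml.
by apply: (@rV_compact R d (fun=> `[- B, B]%classic)) => j; exact: segment_compact.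
Qed.

Lemma closed_box B : closed (box B).
Proof. apply: compact_closed; [exact: norm_hausdorff|exact: compact_box]. Qed.

Lemma box_step0E B c x : box_step B c 0 x = (c * \1_(box B) x)%:E.
Proof.
rewrite /box_step expr0 mulr1 indicE; case: ifPn => [/forallP Bx|/negP nB].
  by rewrite mem_set ?mulr1// => j; have := Bx j.
by rewrite memNset ?mulr0// => Bx; apply: nB; apply/forallP => j /=; exact: Bx.
Qed.

Lemma box_step_ge0 B c k x : 0 <= B -> 0 <= c -> (0 <= box_step B c k x)%E.
Proof.
by move=> B0 c0; rewrite lee_fin; case: ifP => // _; rewrite mulr_ge0 ?exprn_ge0 ?mulr_ge0.
Qed.

Lemma test_measurable_box_step B c : test_measurable (box_step B c 0).
Proof.
move=> d' T u mcu; under eq_fun do rewrite box_step0E.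
apply/measurable_EFinP; apply: measurable_funM; first exact: measurable_cst.
exact: (measurable_indic_closed mcu (@closed_box B)).
Qed.

Lemma box_step_set_coord B c k v t : (k < d)%N -> 0 <= B ->
  box_step B c k (set_coord v k t) =
  ((if [forall j : 'I_d, (k < j)%N ==> (`|v 0 j| <= B)] then c * (2 * B) ^+ k else 0)%:E *
   (\1_(`[- B, B]%classic : set R) t)%:E)%E.
Proof.
move=> kd B0; rewrite /box_step -EFinM indicE; congr (_%:E).
have -> : (t \in (`[- B, B]%classic : set R)) = (`|t| <= B).
  by apply/idP/idP; rewrite inE /= in_itv /= ler_norml.
have -> : [forall j : 'I_d, (k <= j)%N ==> (`|set_coord v k t 0 j| <= B)] =
    [forall j : 'I_d, (k < j)%N ==> (`|v 0 j| <= B)] && (`|t| <= B).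
  apply/forallP/andP => [Bx|[/forallP Bx tB] j].
    split; last by have := Bx (Ordinal kd); rewrite mxE /= leqnn eqxx.
    apply/forallP => j; apply/implyP => kj; have := Bx j.
    by rewrite mxE (ltnW kj) gtn_eqF.
  apply/implyP; rewrite leq_eqVlt => /orP[/eqP kj|kj]; rewrite mxE.
    by rewrite -kj eqxx.
  by rewrite gtn_eqF//; have := Bx j; rewrite kj.
by case: (`|t| <= B); rewrite ?andbT ?andbF ?mulr1 ?mulr0.
Qed.

Lemma integral_box_step B c k v : (k < d)%N -> 0 <= B -> 0 <= c ->
  (\int[mu]_t box_step B c k (set_coord v k t) = box_step B c k.+1 v)%E.
Proof.
move=> kd B0 c0; under eq_integral do rewrite box_step_set_coord//.
set C : R := if _ then _ else _.
have C0 : 0 <= C by rewrite /C; case: ifP => // _; rewrite mulr_ge0 ?exprn_ge0 ?mulr_ge0.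
rewrite ge0_integralZl//; last first.
  by apply/measurable_EFinP; exact: measurable_indic.
rewrite integral_indic// setIT.
transitivity (C%:E * (2 * B)%:E)%E.
  congr (_ * _)%E; have /= -> := @lebesgue_measure_itv R `[- B, B]; rewrite /= lte_fin.
  case: ltP => BB.
    by rewrite -EFinB opprK mulr2n mulrDl mul1r.
  by have -> : 2 * B = 0 by lra.
rewrite -EFinM /box_step /C; case: ifP => _; last by rewrite mul0r.
by rewrite exprSr mulrA.
Qed.

Lemma iter_box_step B c k v : (k <= d)%N -> 0 <= B -> 0 <= c ->
  iter_integral k (box_step B c 0) v = box_step B c k v.
Proof.
move=> + B0 c0; elim: k v => //= k IH v kd.
rewrite -integral_box_step//; apply: eq_integral => t _.
by rewrite IH// ltnW.
Qed.

Lemma integral_Rd_box_step B c : 0 <= B -> 0 <= c ->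
  integral_Rd (box_step B c 0) = (c * (2 * B) ^+ d)%:E.
Proof.
move=> B0 c0; rewrite /integral_Rd iter_box_step// /box_step.
by rewrite ifT//; apply/forallP => j; rewrite leqNgt ltn_ord.
Qed.

Lemma iter_integral_ge0 k h v : (forall x, 0 <= h x)%E -> (0 <= iter_integral k h v)%E.
Proof. by rewrite iter_integralE; exact: seq_integral_ge0. Qed.

Lemma test_measurable_iter_integral k h : (forall x, 0 <= h x)%E ->
  test_measurable h -> test_measurable (iter_integral k h).
Proof. by rewrite (funext (iter_integralE k h)); exact: test_measurable_seq_integral. Qed.

Lemma iter_integral_le k h g v : (forall x, 0 <= h x)%E -> (forall x, h x <= g x)%E ->
  test_measurable h -> test_measurable g ->
  (iter_integral k h v <= iter_integral k g v)%E.
Proof. by rewrite !iter_integralE; exact: seq_integral_le. Qed.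

Lemma test_measurable_cvg (h_ : nat -> 'rV[R]_d -> \bar R) h :
  (forall n, test_measurable (h_ n)) -> (forall x, h_ ^~ x @ \oo --> h x) ->
  test_measurable h.
Proof.
move=> mh hh d' T u mcu.
apply: (emeasurable_fun_cvg (fun n t => h_ n (u t))) => [n|t _].
  exact: mh.
exact: hh.
Qed.

Lemma dominated_convergence_Rd (h_ : nat -> 'rV[R]_d -> \bar R) h B c :
  0 <= B -> 0 <= c ->
  (forall n, test_measurable (h_ n)) -> (forall n x, 0 <= h_ n x)%E ->
  (forall n x, h_ n x <= box_step B c 0 x)%E ->
  (forall x, h_ ^~ x @ \oo --> h x) ->
  integral_Rd (h_ n) @[n --> \oo] --> integral_Rd h.
Proof.
move=> B0 c0 mh h0 hB hh.
have mlim := test_measurable_cvg mh hh.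
have lim0 x : (0 <= h x)%E.
  have -> : h x = limn (h_ ^~ x) by apply/esym/cvg_lim; [|exact: hh].
  by apply: lime_ge; [apply/cvg_ex; exists (h x); exact: hh|exact: nearW].
suff H k v : (k <= d)%N -> iter_integral k (h_ n) v @[n --> \oo] --> iter_integral k h v.
  exact: H.
elim: k v => [v _|k IH v kd]; first exact: hh.
have mf g w : (forall x, 0 <= g x)%E -> test_measurable g ->
    measurable_fun [set: measurableTypeR R] (fun t => iter_integral k g (set_coord w k t)).
  by move=> g0 mg; apply: test_measurable_section; exact: test_measurable_iter_integral.
pose G t := box_step B c k (set_coord v k t).
have G0 t : (0 <= G t)%E by exact: box_step_ge0.
have [|||||_ _] := @dominated_convergence _ _ _ mu _ measurableT
  (fun n t => iter_integral k (h_ n) (set_coord v k t))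
  (fun t => iter_integral k h (set_coord v k t)) G.
- by move=> n; exact: mf.
- exact: mf.
- by apply: aeW => t _; exact: IH (ltnW kd).
- have mG : measurable_fun [set: measurableTypeR R] G.
    have -> : G = (fun t => iter_integral k (box_step B c 0) (set_coord v k t)).
      by apply/funext => t; rewrite iter_box_step// ltnW.
    apply: mf; first by move=> x; exact: box_step_ge0.
    exact: test_measurable_box_step.
  apply/integrableP; split => //.
  under eq_integral do rewrite gee0_abs//.
  by rewrite /G integral_box_step// ltry.
- apply: aeW => t n _ /=; rewrite gee0_abs; last exact: iter_integral_ge0.
  rewrite /G -iter_box_step//; last exact: ltnW.
  by apply: iter_integral_le => //; exact: test_measurable_box_step.
- by [].
Qed.

Lemma integral_Rd_eq_off_hyperplane (i : 'I_d) h g :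
  (forall x, 0 <= h x)%E -> (forall x, 0 <= g x)%E ->
  test_measurable h -> test_measurable g ->
  (forall x, x 0 i != 0 -> h x = g x) -> integral_Rd h = integral_Rd g.
Proof.
move=> h0 g0 mh mg hg; rewrite /integral_Rd !iter_integralE.
have id : (i : nat) \in rev (iota 0 d) by rewrite mem_rev mem_iota /= add0n.
have [|s' E] := seq_integral_innermost (R := R) (d := d) _ id.
  by rewrite rev_uniq iota_uniq.
rewrite !E//; apply: eq_seq_integral => w /=.
apply: ae_eq_integral => //; try exact: test_measurable_section.
exists [set 0]; split => //; first exact: lebesgue_measure_set1.
move=> t /= nE; apply: contrapT => t0; apply: nE => _; apply: hg.
by rewrite mxE eqxx; apply/eqP.
Qed.

End Boxes.

(** * Attainable maps and measure preservation *)

Section RowVectors.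
Context {R : realType} {d : nat}.
Implicit Types (x y v w : 'rV[R]_d).

Lemma norm_coord x j : `|x 0 j| <= `|x|.
Proof.
rewrite [leRHS]/Num.Def.normr/= mx_normrE.
exact: (le_bigmax _ (fun ij : 'I_1 * 'I_d => `|x ij.1 ij.2|) (0, j)).
Qed.

Lemma norm_row_le x (c : R) : 0 <= c -> (forall j, `|x 0 j| <= c) -> `|x| <= c.
Proof.
move=> c0 xc; rewrite [leLHS]/Num.Def.normr/= mx_normrE; apply: bigmax_le => //.
by move=> [i j] _ /=; rewrite (ord1 i); exact: xc.
Qed.

Lemma cvg_row {T : Type} {F : set_system T} {FF : Filter F} (f : T -> 'rV[R]_d) v :
  (forall j, f t 0 j @[t --> F] --> v 0 j) -> f t @[t --> F] --> v.
Proof.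
move=> fv; apply/cvgrPdist_le => /= e e0.
have : \forall t \near F, forall j, `|v 0 j - f t 0 j| <= e.
  by apply: filter_forall => j; move/cvgrPdist_le : (fv j) => /(_ e e0).
apply: filterS => t vf; apply: norm_row_le => [|j]; first exact: ltW.
by rewrite !mxE; exact: vf.
Qed.

Lemma is_derive_coord (y : R -> 'rV[R]_d) (s : R) v j :
  is_derive s (1 : R) y v -> is_derive s (1 : R) (fun t => y t 0 j) (v 0 j).
Proof.
move=> [dy <-]; split; first exact: (derivable_mxP _ _ _).1.
by rewrite derive_mx// mxE.
Qed.

Lemma is_derive_row (y : R -> 'rV[R]_d) (s : R) v :
  (forall j, is_derive s (1 : R) (fun t => y t 0 j) (v 0 j)) -> is_derive s (1 : R) y v.
Proof.
move=> dyj; have dy : derivable y s 1.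
  by apply/derivable_mxP => i j; rewrite (ord1 i); have [] := dyj j.
split=> //; rewrite derive_mx//; apply/rowP => j; rewrite mxE.
by have [_ <-] := dyj j.
Qed.

Lemma is_derive_row_continuous (y v : R -> 'rV[R]_d) :
  (forall s, is_derive s (1 : R) y (v s)) -> continuous y.
Proof.
move=> dy s; apply: cvg_row => j.
suff : {for s, continuous (fun s => y s 0 j)} by [].
apply: differentiable_continuous; apply/derivable1_diffP.
by have [] := is_derive_coord j (dy s).
Qed.

Definition lipschitz_field (L : R) (g : 'rV[R]_d -> 'rV[R]_d) :=
  forall a b, `|g a - g b| <= L * `|a - b|.

Lemma lipschitz_field_locally L g : lipschitz_field L g -> locally_lipschitz g.
Proof. by move=> Lg x; exists 1 => //; exists L => a b _ _; exact: Lg. Qed.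

Lemma lipschitz_continuous (W : normedModType R) (L : R) (f : 'rV[R]_d -> W) : 0 <= L ->
  (forall a b, `|f a - f b| <= L * `|a - b|) -> continuous f.
Proof.
move=> L0 Lg x; apply/(@cvgrPdist_le R _ _ (nbhs x) (nbhs_filter x)) => /= e e0.
have L1 : 0 < L + 1 by rewrite ltr_wpDl.
have e1 : 0 < e / (L + 1) by exact: divr_gt0.
have := (@cvgrPdist_le R _ _ (nbhs x) (nbhs_filter x) id x).1 (@cvg_id _ (nbhs x)) _ e1.
apply: filterS => y /= xy; apply: le_trans (Lg x y) _.
move: xy; rewrite ler_pdivlMr// mulrC; apply: le_trans.
by rewrite ler_wpM2r// lerDl.
Qed.

Lemma zero_derive_cst (f : R -> R) (t : R) : 0 <= t ->
  {within `[0, t], continuous f} ->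
  (forall s, 0 < s < t -> is_derive s (1 : R) f 0) -> f t = f 0.
Proof.
rewrite le_eqVlt => /predU1P[<-//|t0] cf df.
have df' s : s \in `]0, t[ -> is_derive s (1 : R) f 0 by rewrite in_itv; exact: df.
have [c _] := @MVT R f (fun=> 0) 0 t t0 df' cf.
by rewrite mul0r => /eqP; rewrite subr_eq0 => /eqP.
Qed.

End RowVectors.

Section Reach.
Context {R : realType} {d : nat} (Fam : set ('rV[R]_d -> 'rV[R]_d)).
Implicit Types (g phi psi : 'rV[R]_d -> 'rV[R]_d) (S : set 'rV[R]_d).

Inductive reach : ('rV[R]_d -> 'rV[R]_d) -> Prop :=
| reach_id : reach id
| reach_step g t phi psi : reach phi -> Fam g -> flow_on g t setT psi ->
    reach (psi \o phi).

Lemma reach_comp phi psi : reach phi -> reach psi -> reach (psi \o phi).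
Proof.
move=> rphi; elim=> // g t psi1 psi2 _ IH Fg fl.
by rewrite -compA; exact: reach_step IH Fg fl.
Qed.

Lemma reach_flow g t psi : Fam g -> flow_on g t setT psi -> reach psi.
Proof. exact: (reach_step reach_id). Qed.

Lemma flow_on_sub g t S S' phi : S `<=` S' -> flow_on g t S' phi -> flow_on g t S phi.
Proof. by move=> SS' [t0 fl]; split=> // x /SS'; exact: fl. Qed.

Lemma attainable_reach S phi psi :
  attainable_on Fam S phi -> reach psi -> attainable_on Fam S (psi \o phi).
Proof.
move=> aphi; elim=> // g t psi1 psi2 _ IH Fg fl.
by rewrite -compA; apply: att_comp IH Fg _; exact: flow_on_sub fl.
Qed.

Lemma flow_on_time0 g S : flow_on g 0 S id.
Proof.
split=> // x _; exists (fun=> x); split => //.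
- exact/continuous_subspaceT/cst_continuous.
- by move=> s /andP[s0 /(lt_trans s0)]; rewrite ltxx.
Qed.

Lemma reach_attainable g S psi : Fam g -> reach psi -> attainable_on Fam S psi.
Proof. by move=> Fg; apply: (@attainable_reach S id); exact: att_flow Fg (flow_on_time0 g S). Qed.

End Reach.

Section MeasurePreserving.
Context {R : realType} {d : nat}.
Implicit Types (phi : 'rV[R]_d -> 'rV[R]_d).

Definition measure_preserving phi := preserves_measurable phi /\
  forall h : 'rV[R]_d -> \bar R, (forall x, 0 <= h x)%E -> test_measurable h ->
    integral_Rd (h \o phi) = integral_Rd h.

Lemma measure_preserving_comp phi psi :
  measure_preserving phi -> measure_preserving psi -> measure_preserving (psi \o phi).
Proof.
move=> [mphi iphi] [mpsi ipsi]; split=> [d' T u mu|h h0 mh].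
  exact: (mpsi _ _ (phi \o u)) (mphi _ _ _ mu).
by rewrite compA iphi ?ipsi//; [move=> x; exact: h0|exact: (test_measurable_comp mh mpsi)].
Qed.

Lemma coord_le_eucl_norm (v : 'rV[R]_d) j : `|v 0 j| <= eucl_norm v.
Proof.
rewrite -sqrtr_sqr ler_wsqrtr// (bigD1 j)//= lerDl.
by apply: sumr_ge0 => i _; exact: sqr_ge0.
Qed.

(* A measure preserving map sends at most half of the unit cube
   into the cube of half the side, so it stays away from the zero map. *)
Lemma measure_preserving_not_universal_approximation (p : R) Fam :
  (0 < d)%N -> 1 <= p ->
  (forall S phi, attainable_on Fam S phi ->
    exists2 Phi, {in S, phi =1 Phi} & measure_preserving Phi) ->
  ~ universal_approximation_Lp p Fam.
Proof.
move=> d0 p1 mpF uap.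
have p0 : 0 < p by exact: lt_le_trans p1.
pose q : R := (1 / 4) `^ p.
have q0 : 0 < q by rewrite powR_gt0.
pose eps : R := (q / 2) `^ p^-1.
have eps0 : 0 < eps by rewrite powR_gt0 ?divr_gt0.
pose K := box (d := d) (1 / 2 : R).
have cF : continuous ((fun=> 0) : 'rV[R]_d -> 'rV[R]_d) by exact: cst_continuous.
have [phi [/mpF[Phi phiE [mPhi iPhi]]]] := uap _ cF _ (@compact_box R d (1 / 2)) _ eps0.
apply/negP; rewrite -leNgt.
pose h (x : 'rV[R]_d) : \bar R := ((\1_K x : R) * eucl_norm (0 - Phi x) `^ p)%:E.
rewrite /Lp_dist (_ : (fun x => _) = h); last first.
  apply/funext => x; rewrite /h indicE; case: (boolP (x \in K)) => [xK|_].
    by rewrite (phiE x).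
  by rewrite !mul0r.
have h0 x : (0 <= h x)%E by rewrite lee_fin mulr_ge0 ?powR_ge0// indicE ler0n.
have mh : test_measurable h.
  exact: (test_measurable_Lp_integrand p (@closed_box R d (1 / 2)) cF mPhi).
suff qI : ((q / 2)%:E <= integral_Rd h)%E.
  rewrite -[eps%:E]poweR_EFin; apply: gt0_ler_poweR => //.
  - by rewrite invr_ge0 ltW.
  - by rewrite in_itv /= lee_fin divr_ge0 ?leey// ltW.
  - by rewrite in_itv /= leey andbT iter_integral_ge0.
pose b2 := box_step (d := d) (1 / 2) (1 : R) 0.
pose b4 := box_step (d := d) (1 / 4) (1 : R) 0.
have b40 x : (0 <= b4 x)%E by exact: box_step_ge0.
have mb4 : test_measurable b4 by exact: test_measurable_box_step.
have b2le x : (b2 x <= (q^-1)%:E * h x + (b4 \o Phi) x)%E.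
  rewrite /b2 /b4 /= !box_step0E /h -EFinM -EFinD lee_fin -/K !mul1r.
  rewrite [\1_K x]indicE; case: (boolP (x \in K)) => xK; last first.
    by rewrite mul0r mulr0 add0r indicE; case: (_ \in _).
  rewrite mul1r indicE; case: (boolP (Phi x \in _)) => [_|nPhi].
    by rewrite lerDr mulr_ge0 ?powR_ge0// invr_ge0 ltW.
  rewrite addr0 ler_pdivlMl// mulr1.
  apply: ge0_ler_powR; rewrite ?nnegrE ?sqrtr_ge0//; first exact: ltW.
  have [j /negP] : exists j, ~ `|Phi x 0 j| <= 1 / 4.
    apply/existsNP => Px; move/negP : nPhi; apply; rewrite inE => j.
    by rewrite -[leRHS]mul1r; exact: Px.
  rewrite -ltNge => /ltW /le_trans; apply.
  by apply: le_trans (coord_le_eucl_norm _ j); rewrite !mxE add0r normrN.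
have : (integral_Rd b2 <= (q^-1)%:E * integral_Rd h + integral_Rd b4)%E.
  rewrite -(iPhi b4)//.
  have mb4P : test_measurable (b4 \o Phi) by exact: (test_measurable_comp mb4 mPhi).
  have mqh : test_measurable (fun x => (q^-1)%:E * h x)%E.
    by move=> d' T u mu; apply: measurable_funeM; exact: mh.
  rewrite /integral_Rd !iter_integralE -seq_integralZ ?invr_ge0 ?(ltW q0)//.
  rewrite -seq_integralD//; first last.
  - by move=> x; exact: b40.
  - by move=> x; rewrite mule_ge0// lee_fin invr_ge0 ltW.
  apply: seq_integral_le => //.
  - by move=> x; exact: box_step_ge0.
  - exact: test_measurable_box_step.
  - by move=> d' T u mu; apply: emeasurable_funD; [exact: mqh|exact: mb4P].
rewrite !integral_Rd_box_step// !mul1r.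
have -> : 2 * 2^-1 = 1 :> R by lra.
rewrite expr1n.
have dle : (2 * 4^-1) ^+ d <= 1 / 2 :> R.
  rewrite -(prednK d0) exprS.
  have : (2 * 4^-1) ^+ d.-1 <= 1 :> R by rewrite exprn_ile1//; lra.
  have : 0 <= (2 * 4^-1) ^+ d.-1 :> R by rewrite exprn_ge0//; lra.
  by move: (_ ^+ _); move=> z; lra.
have : (0 <= integral_Rd h)%E by exact: iter_integral_ge0.
case: (integral_Rd h) => [I| |] // I0; last by rewrite leey.
rewrite -EFinM -EFinD !lee_fin => Ile.
have : 1 / 2 <= q^-1 * I by lra.
by rewrite ler_pdivlMl// => H; apply: le_trans H; rewrite mul1r.
Qed.

End MeasurePreserving.

(** * Shears *)

Section Shears.
Context {R : realType} {d : nat}.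
Implicit Types (u w x y : 'rV[R]_d).

Definition dotr u x : R := \sum_j u 0 j * x 0 j.

Definition ridge (c0 b r s : R) : R := c0 * s + Num.max 0 (r - `|s - b|).

Definition shear w u (c0 b r : R) x : 'rV[R]_d := ridge c0 b r (dotr u x) *: w.

Lemma dotrDZ u x y (t : R) : dotr u (x + t *: y) = dotr u x + t * dotr u y.
Proof.
rewrite /dotr mulr_sumr -big_split; apply: eq_bigr => j _ /=.
by rewrite !mxE mulrDr mulrCA.
Qed.

Lemma dotr_delta u i (c : R) : dotr u (c *: delta_mx 0 i) = c * u 0 i.
Proof.
rewrite /dotr (bigD1 i)//= big1 => [|j ji]; last by rewrite !mxE (negbTE ji) andbF !mulr0.
by rewrite !mxE !eqxx mulr1 addr0 mulrC.
Qed.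

Lemma dotr_deltal j x : dotr (delta_mx 0 j) x = x 0 j.
Proof.
rewrite /dotr (bigD1 j)//= big1 => [|i ij]; last by rewrite !mxE (negbTE ij) andbF mul0r.
by rewrite !mxE !eqxx mul1r addr0.
Qed.

Lemma dotr_lipschitz u x y : `|dotr u x - dotr u y| <= (\sum_j `|u 0 j|) * `|x - y|.
Proof.
rewrite /dotr -sumrB mulr_suml; apply: le_trans (ler_norm_sum _ _ _) _.
apply: ler_sum => j _; rewrite -mulrBr normrM ler_wpM2l//.
by have := norm_coord (x - y) j; rewrite !mxE.
Qed.

Lemma continuous_dotr u : continuous (dotr u).
Proof. by apply: lipschitz_continuous (dotr_lipschitz u); exact: sumr_ge0. Qed.

Lemma ridge_lipschitz c0 b r s s' :
  `|ridge c0 b r s - ridge c0 b r s'| <= (`|c0| + 1) * `|s - s'|.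
Proof.
rewrite /ridge opprD addrACA -mulrBr mulrDl mul1r.
apply: le_trans (ler_normD _ _) _; rewrite normrM lerD2l.
have H : `|(r - `|s - b|) - (r - `|s' - b|)| <= `|s - s'|.
  have -> : (r - `|s - b|) - (r - `|s' - b|) = `|s' - b| - `|s - b| by ring.
  by apply: le_trans (ler_dist_dist _ _) _; rewrite opprB addrA subrK distrC.
apply: le_trans H; move: (r - `|s - b|) (r - `|s' - b|) => p q.
by rewrite /Num.max; case: ltP => p0; case: ltP => q0;
  rewrite ?subrr ?normr0 ?normr_ge0 ?sub0r ?subr0// ler_norml; apply/andP; split;
  (have [?|?] := lerP 0 (p - q); [rewrite ger0_norm//|rewrite ltr0_norm//]); lra.
Qed.

Lemma shear_lipschitz w u c0 b r :
  exists2 L, 0 <= L & lipschitz_field L (shear w u c0 b r).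
Proof.
exists ((`|c0| + 1) * (\sum_j `|u 0 j|) * `|w|) => [|x y].
  by rewrite !mulr_ge0// ?addr_ge0// sumr_ge0.
rewrite /shear -scalerBl normrZ.
rewrite -[leRHS]mulrA [`|w| * _]mulrC mulrA.
rewrite ler_wpM2r//; apply: le_trans (ridge_lipschitz _ _ _ _ _) _.
rewrite -mulrA ler_wpM2l ?addr_ge0//; exact: dotr_lipschitz.
Qed.

Lemma shear_along w u c0 b r x (t : R) : dotr u w = 0 ->
  shear w u c0 b r (x + t *: w) = shear w u c0 b r x.
Proof. by move=> uw; rewrite /shear dotrDZ uw mulr0 addr0. Qed.

Lemma shear_flow w u c0 b r t S : dotr u w = 0 -> 0 <= t ->
  flow_on (shear w u c0 b r) t S (fun x => x + t *: shear w u c0 b r x).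
Proof.
move=> uw t0; split=> // x _; set g := shear w u c0 b r.
pose y (s : R) := x + s *: g x.
have dy s : is_derive s (1 : R) y (g x).
  apply: is_derive_row => j.
  have -> : (fun s => y s 0 j) = (fun s => x 0 j + s * g x 0 j).
    by apply/funext => s'; rewrite !mxE.
  by apply: is_derive_eq; rewrite add0r scaler0 add0r /GRing.scale /= mul1r mulr1.
exists y; split => //.
- by rewrite /y scale0r addr0.
- exact/continuous_subspaceT/(is_derive_row_continuous dy).
- move=> s _; have -> : g (y s) = g x by rewrite /y {2}/g /shear scalerA /g shear_along.
  exact: dy.
Qed.

Lemma shear_flow_unique w u c0 b r t S phi : dotr u w = 0 ->
  flow_on (shear w u c0 b r) t S phi ->
  {in S, forall x, phi x = x + t *: shear w u c0 b r x}.
Proof.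
move=> uw [t0 fl] x; rewrite inE => /fl[y [y0 cy dy ->]] {fl}.
set g := shear w u c0 b r in dy *.
have cy_sub s : 0 <= s <= t -> {within `[0, s], continuous y}.
  move=> /andP[s0 st].
  by apply: continuous_subspaceW cy; apply: subset_itvl; rewrite bnd_simp.
have dyj j s : 0 < s < t -> is_derive s (1 : R) (fun s => y s 0 j) (g (y s) 0 j).
  by move=> /dy /(is_derive_coord j).
have cdot s : 0 <= s <= t -> dotr u (y s) = dotr u x.
  move=> st; have /andP[s0 le_st] := st; rewrite -y0.
  apply: (@zero_derive_cst R (fun s => dotr u (y s)) s s0).
    move=> z; apply: (@continuous_comp (subspace `[0, s]%classic) _ _ y (dotr u)).
      exact: cy_sub.
    exact: continuous_dotr.
  move=> s' /andP[s'0 s's].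
  have -> : (fun s => dotr u (y s)) = (\sum_j (fun s => u 0 j * y s 0 j)).
    by apply/funext => z; rewrite fct_sumE.
  have -> : 0 = \sum_j (u 0 j * g (y s') 0 j) :> R.
    have : dotr u (g (y s')) = 0.
      rewrite /g /shear -[X in dotr u X]add0r dotrDZ uw mulr0 addr0.
      by rewrite /dotr big1// => j _; rewrite mxE mulr0.
    by [].
  apply: is_derive_sum => j.
  have := dyj j s' (introT andP (conj s'0 (lt_le_trans s's le_st))) => dj.
  exact: is_derive_eq.
have gE s : 0 <= s <= t -> g (y s) = g x by move=> /cdot E; rewrite /g /shear E.
apply/rowP => j; rewrite !mxE.
pose f (s : R) := y s 0 j - s * g x 0 j.
have : f t = f 0.
  apply: zero_derive_cst => //.
    move=> z; apply: (@continuousB R R (subspace `[0, t]%classic) (fun s => y s 0 j)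
      (fun s => s * g x 0 j)).
      apply: (@continuous_comp (subspace `[0, t]%classic) _ _ y
        (fun M : 'rV[R]_d => M 0 j) z (cy z)).
      exact: coord_continuous.
    apply: (@continuous_subspaceT _ _ _ (fun s : R => s * g x 0 j)) => {}z.
    exact: mulrr_continuous.
  move=> s st; have := dyj j s st; rewrite gE; last by case/andP: st => *; rewrite !ltW.
  by move=> dj; apply: is_derive_eq; rewrite scaler0 add0r /GRing.scale /= ?mulr1 ?mul1r subrr.
rewrite /f mul0r subr0 y0 => /eqP; rewrite subr_eq => /eqP ->.
by rewrite /g mxE.
Qed.

Lemma continuous_shear w u c0 b r (t : R) :
  continuous (fun x => x + t *: shear w u c0 b r x).
Proof.
have [L L0 gL] := shear_lipschitz w u c0 b r.
apply: (@lipschitz_continuous R d _ (1 + `|t| * L)) => [|x y].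
  by rewrite addr_ge0// mulr_ge0.
rewrite opprD addrACA -scalerBr mulrDl mul1r; apply: le_trans (ler_normD _ _) _.
by rewrite lerD2l normrZ -mulrA ler_wpM2l.
Qed.

Lemma measure_preserving_shear (i : 'I_d) (c : R) u c0 b r t : u 0 i = 0 ->
  measure_preserving (fun x => x + t *: shear (c *: delta_mx 0 i) u c0 b r x).
Proof.
move=> ui.
have mphi : preserves_measurable (fun x => x + t *: shear (c *: delta_mx 0 i) u c0 b r x).
  exact/preserves_measurable_continuous/continuous_shear.
pose a x := t * (ridge c0 b r (dotr u x) * c).
have phiE : (fun x => x + t *: shear (c *: delta_mx 0 i) u c0 b r x) =
    (fun x => x + a x *: delta_mx 0 i).
  by apply/funext => x; rewrite /shear !scalerA /a !mulrA.
split=> // h h0 mh; rewrite phiE in mphi *; apply: integral_Rd_shear => // x s.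
rewrite /a; congr (_ * (ridge _ _ _ _ * _)); apply: eq_bigr => j _; rewrite mxE.
by case: eqVneq => [/val_inj->|//]; rewrite ui !mul0r.
Qed.

End Shears.

(** * Interpolation by shears *)

Lemma finite_lower_bound {R : realType} (J : finType) (f : J -> R) :
  (forall m, 0 < f m) -> exists2 r, 0 < r & forall m, r <= f m.
Proof.
move=> f0; exists (\big[Num.min/1]_m f m) => [|m]; last exact: bigmin_le.
by apply: lt_bigmin.
Qed.

Lemma small_nonroot {R : realType} (q : {poly R}) (e : R) : q != 0 -> 0 < e ->
  exists2 c, 0 < c < e & ~~ root q c.
Proof.
move=> q0 e0; apply: contrapT => H.
pose s := [seq e / n.+2%:R | n <- iota 0 (size q)].
have : (size s < size q)%N.
  apply: max_poly_roots => //.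
    apply/allP => _ /mapP[n _ ->]; apply/negPn/negP => nr; apply: H.
    exists (e / n.+2%:R) => //; rewrite divr_gt0//= ltr_pdivrMr//.
    by rewrite ltr_pMr// ltr1n.
  rewrite map_inj_uniq ?iota_uniq// => n n' /(mulfI (lt0r_neq0 e0)) /invr_inj /eqP.
  by rewrite eqr_nat => /eqP[].
by rewrite size_map size_iota ltnn.
Qed.

Section Interpolation.
Context {R : realType} {n : nat}.
Local Notation d := n.+2.
Implicit Types (x y z u : 'rV[R]_d) (i j : 'I_d).

Definition row_poly z : {poly R} := \poly_(j < d) z 0 (inord j).

Lemma row_poly_eq0 z : row_poly z = 0 -> z = 0.
Proof.
move=> z0; apply/rowP => j; rewrite mxE.
have := coef_poly d (fun k : nat => z 0 (inord k)) j.
by rewrite ltn_ord inord_val -/(row_poly z) z0 coef0.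
Qed.

Lemma generic_functional (J : finType) (zs : J -> 'rV[R]_d) : (forall m, zs m != 0) ->
  exists2 u : 'rV[R]_d, u 0 0 = 0 & forall m, zs m 0 0 + dotr u (zs m) != 0.
Proof.
move=> zs0; pose q := \prod_m row_poly (zs m).
have q0 : q != 0.
  apply/prodf_neq0 => m _; apply: contra (zs0 m) => /eqP/row_poly_eq0->; exact: eqxx.
have [c _ nr] := small_nonroot q0 (ltr01 : 0 < 1 :> R).
exists (\row_j (if j == 0 then 0 else c ^+ j)); first by rewrite mxE eqxx.
move=> m; apply: contra nr => E.
rewrite /q (bigD1 m)//= rootM; apply/orP; left.
rewrite /root /row_poly horner_poly; apply/eqP; rewrite -[RHS](eqP E).
have E0 : inord 0 = 0 :> 'I_d by apply/val_inj; rewrite /= inordK.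
rewrite (bigD1 ord0)//= E0 mulr1; congr (_ + _).
rewrite /dotr [RHS](bigD1 ord0)//= mxE eqxx mul0r add0r; apply: eq_bigr => j j0.
by rewrite inord_val mxE (negbTE j0) mulrC.
Qed.

Definition shear_rich (Fam : set ('rV[R]_d -> 'rV[R]_d)) :=
  (forall (c : R) i u, u 0 i = 0 -> Fam (shear (c *: delta_mx 0 i) u 1 0 0)) /\
  (forall (c : R) i j b r, i != j -> 0 < r <= `|b| ->
     Fam (shear (c *: delta_mx 0 i) (delta_mx 0 j) 0 b r)).

Context (Fam : set ('rV[R]_d -> 'rV[R]_d)) (rich : shear_rich Fam).

Definition continuous_reach phi := reach Fam phi /\ continuous phi.

Lemma continuous_reach_comp phi psi :
  continuous_reach phi -> continuous_reach psi -> continuous_reach (psi \o phi).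
Proof.
move=> [rphi cphi] [rpsi cpsi]; split; first exact: reach_comp.
by move=> x; apply: continuous_comp (cphi x) (cpsi (phi x)).
Qed.

Lemma continuous_reach_id : continuous_reach id.
Proof. by split; [exact: reach_id|move=> x; exact: cvg_id]. Qed.

Lemma continuous_reach_shear c i u c0 b r : u 0 i = 0 ->
  Fam (shear (c *: delta_mx 0 i) u c0 b r) ->
  continuous_reach (fun x => x + (c * ridge c0 b r (dotr u x)) *: delta_mx 0 i).
Proof.
move=> ui Fg.
have -> : (fun x => x + (c * ridge c0 b r (dotr u x)) *: delta_mx 0 i) =
    (fun x => x + 1 *: shear (c *: delta_mx 0 i) u c0 b r x).
  by apply/funext => x; rewrite scale1r /shear scalerA mulrC.
split; last exact: continuous_shear.
by apply: (reach_flow Fg); apply: shear_flow => //; rewrite dotr_delta ui mulr0.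
Qed.

Lemma continuous_reach_linear c u : u 0 0 = 0 ->
  continuous_reach (fun x => x + (c * dotr u x) *: delta_mx 0 0).
Proof.
move=> u0; have := continuous_reach_shear u0 (rich.1 c 0 u u0).
congr continuous_reach; apply/funext => x; rewrite /ridge mul1r subr0 sub0r.
by rewrite (_ : Num.max _ _ = 0) ?addr0//; apply/max_idPl; rewrite oppr_le0.
Qed.

Lemma continuous_reach_set_coord (J : finType) (zs : J -> 'rV[R]_d) i j (tau : J -> R) :
  i != j -> injective (fun m => zs m 0 j) -> (forall m, zs m 0 j != 0) ->
  exists2 phi, continuous_reach phi & forall m, phi (zs m) = set_coord (zs m) i (tau m).
Proof.
move=> ij zinj z0.
have [|r r0 rle] := @finite_lower_bound R (J * J)%type
    (fun mk => if mk.1 == mk.2 then `|zs mk.1 0 j| else `|zs mk.1 0 j - zs mk.2 0 j|).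
  move=> [m k] /=; case: eqVneq => [_|mk]; first by rewrite normr_gt0.
  by rewrite normr_gt0 subr_eq0; apply: contra mk => /eqP/zinj->.
pose c m := (tau m - zs m 0 i) / r.
pose tent m x := ridge 0 (zs m 0 j) r (dotr (delta_mx 0 j) x).
have tentE m k : tent m (zs k) = if m == k then r else 0.
  rewrite /tent /ridge dotr_deltal mul0r add0r.
  have := rle (k, m); rewrite /= eq_sym; case: eqVneq => [->|mk] rl.
    by rewrite subrr normr0 subr0; apply/max_idPr; exact: ltW.
  by apply/max_idPl; rewrite subr_le0.
have H (l : seq J) :
    continuous_reach (fun x => x + (\sum_(m <- l) c m * tent m x) *: delta_mx 0 i).
  elim: l => [|m l IH].
    have := continuous_reach_id; congr continuous_reach; apply/funext => x.
    by rewrite big_nil scale0r addr0.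
  have ji : (delta_mx 0 j : 'rV[R]_d) 0 i = 0 by rewrite mxE (negbTE ij) andbF.
  have rm : 0 < r <= `|zs m 0 j| by rewrite r0; have := rle (m, m); rewrite /= eqxx.
  have := continuous_reach_comp IH (continuous_reach_shear ji (rich.2 (c m) i j _ _ ij rm)).
  congr continuous_reach; apply/funext => x /=.
  have -> : dotr (delta_mx 0 j) (x + (\sum_(m <- l) c m * tent m x) *: delta_mx 0 i) =
      dotr (delta_mx 0 j) x.
    by rewrite dotrDZ -[delta_mx 0 i]scale1r dotr_delta ji !mulr0 addr0.
  by rewrite big_cons -addrA -scalerDl [_ + c m * _]addrC.
exists (fun x => x + (\sum_(m <- index_enum J) c m * tent m x) *: delta_mx 0 i).
  exact: H.
move=> k; rewrite (bigD1 k)//= big1 => [|m mk]; last by rewrite tentE (negbTE mk) mulr0.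
rewrite tentE eqxx addr0 /c divfK ?gt_eqF//.
apply/rowP => l; rewrite !mxE /=; case: (eqVneq (l : nat) i) => [/val_inj->|li].
  by rewrite eqxx mulr1 addrC subrK.
by rewrite (_ : (l == i) = false) ?mulr0 ?addr0//; apply: contraNF li => /eqP->.
Qed.

Lemma continuous_reach_coords (J : finType) (zs ys : J -> 'rV[R]_d) (l : seq 'I_d) :
  0 \notin l -> injective (fun m => zs m 0 0) -> (forall m, zs m 0 0 != 0) ->
  exists2 phi, continuous_reach phi &
    forall m, phi (zs m) = \row_i (if i \in l then ys m 0 i else zs m 0 i).
Proof.
elim: l => [_ _ _|i l IH].
  by exists id => [|m]; [exact: continuous_reach_id|apply/rowP => i; rewrite mxE].
rewrite inE negb_or => /andP[i0 l0] zinj z0.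
have [phi rphi phiE] := IH l0 zinj z0.
have phi0 m : phi (zs m) 0 0 = zs m 0 0 by rewrite phiE mxE (negbTE l0).
have [|||psi rpsi psiE] := continuous_reach_set_coord (zs := phi \o zs) (i := i) (j := 0)
  (fun m => ys m 0 i).
- by rewrite eq_sym.
- by move=> m k /=; rewrite !phi0; exact: zinj.
- by move=> m /=; rewrite phi0.
exists (psi \o phi); first exact: continuous_reach_comp.
move=> m /=; rewrite psiE /=; apply/rowP => k; rewrite !mxE phiE mxE inE.
case: (eqVneq (k : nat) i) => [/val_inj->|ki]; first by rewrite eqxx.
by rewrite (_ : (k == i) = false)//; apply: contraNF ki => /eqP->.
Qed.

Lemma continuous_reach_interpolation (J : finType) (xs ys : J -> 'rV[R]_d) :
  injective xs -> injective ys -> (forall m, xs m != 0) -> (forall m, ys m != 0) ->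
  exists2 phi, continuous_reach phi & forall m, phi (xs m) = ys m.
Proof.
have straighten (zs : J -> 'rV[R]_d) : injective zs -> (forall m, zs m != 0) ->
    exists u : 'rV[R]_d, [/\ u 0 0 = 0,
      injective (fun m => (zs m + dotr u (zs m) *: delta_mx 0 0) 0 0) &
      forall m, (zs m + dotr u (zs m) *: delta_mx 0 0) 0 0 != 0].
  move=> zinj z0.
  have [|u u0 uN0] := @generic_functional (J * J)%type
      (fun mk => if mk.1 == mk.2 then zs mk.1 else zs mk.1 - zs mk.2).
    move=> [m k] /=; case: (eqVneq m k) => [//|mk].
    by rewrite subr_eq0; apply: contra mk => /eqP/zinj->.
  exists u; split=> // [m k|m]; last first.
    by have := uN0 (m, m); rewrite /= eqxx !mxE eqxx mulr1.
  rewrite !mxE !eqxx !mulr1 => E; apply/eqP; apply: contraT => mk.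
  have := uN0 (m, k); rewrite /= (negbTE mk).
  rewrite -[zs k]scale1r -scaleNr dotrDZ !mxE.
  by rewrite mulN1r addrACA mulN1r -opprD E subrr eqxx.
move=> xinj yinj x0 y0.
have [u [u0 Xinj X0]] := straighten _ xinj x0.
have [v [v0 Yinj Y0]] := straighten _ yinj y0.
have r1 := continuous_reach_linear 1 u0.
have r4 := continuous_reach_linear (-1) v0.
pose X m := xs m + dotr u (xs m) *: delta_mx 0 0.
pose Y m := ys m + dotr v (ys m) *: delta_mx 0 0.
have idx_inj : injective (fun m : J => (enum_rank m).+1%:R : R).
  by move=> m k /eqP; rewrite eqr_nat eqSS => /eqP/val_inj/enum_rank_inj.
have [//|//|//|phi1 r2 phi1E] := continuous_reach_set_coord (zs := X) (i := 1) (j := 0)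
  (fun m => (enum_rank m).+1%:R).
pose Z1 m := set_coord (X m) 1 (enum_rank m).+1%:R.
have Z1E m : Z1 m 0 1 = (enum_rank m).+1%:R by rewrite mxE.
have [//|||phi2 r3 phi2E] := continuous_reach_set_coord (zs := Z1) (i := 0) (j := 1)
  (fun m => Y m 0 0).
- by move=> m k; rewrite !Z1E; exact: idx_inj.
- by move=> m; rewrite Z1E pnatr_eq0.
pose Z2 m := set_coord (Z1 m) 0 (Y m 0 0).
have Z2E m : Z2 m 0 0 = Y m 0 0 by rewrite mxE.
have [|||phi3 r5 phi3E] := @continuous_reach_coords J Z2 Y [seq i <- enum 'I_d | i != 0].
- by rewrite mem_filter eqxx.
- by move=> m k; rewrite !Z2E; exact: Yinj.
- by move=> m; rewrite Z2E; exact: Y0.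
exists ((fun x => x + (-1 * dotr v x) *: delta_mx 0 0) \o phi3 \o phi2 \o phi1 \o
    (fun x => x + (1 * dotr u x) *: delta_mx 0 0)).
  do 4 (apply: continuous_reach_comp => //).
move=> m /=; rewrite mul1r -/(X m) phi1E -/(Z1 m) phi2E -/(Z2 m) phi3E.
have -> : \row_i (if i \in [seq i <- enum 'I_d | i != 0] then Y m 0 i else Z2 m 0 i) = Y m.
  apply/rowP => i; rewrite mxE mem_filter mem_enum andbT.
  by case: eqVneq => [->|//]; rewrite Z2E.
rewrite mulN1r {2}/Y dotrDZ -[delta_mx 0 0]scale1r dotr_delta v0 !mulr0 addr0.
by rewrite scale1r scaleNr addrK.
Qed.

End Interpolation.

(** * Logistic flow in the cells of a grid *)

Section Logistic.
Context {R : realType}.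
Implicit Types (s t a b : R).

Definition fracn s : R := s - (Num.truncn s)%:R.

Definition cell_speed s : R := fracn s * (1 - fracn s).

Definition odd_cell_speed s : R := Num.sg s * cell_speed `|s|.

(* The solution at time [t] of [u' = u (1 - u)] with initial value [u]. *)
Definition logistic t (u : R) : R := 1 - (1 - u) / (1 - u + u * expR t).

Definition cell_flow t s : R :=
  Num.sg s * ((Num.truncn `|s|)%:R + logistic t (fracn `|s|)).

Definition cell_limit s : R :=
  Num.sg s * ((Num.truncn `|s|)%:R + (0 < fracn `|s|)%R%:R).

Lemma fracn_itv s : 0 <= s -> 0 <= fracn s < 1.
Proof.
by move=> /Num.Theory.truncn_itv; rewrite /fracn -natr1 => /andP[? ?]; apply/andP; split; lra.
Qed.

Lemma fracnD (k : nat) u : 0 <= u < 1 -> fracn (k%:R + u) = u.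
Proof.
move=> /andP[u0 u1]; have E : Num.truncn (k%:R + u) = k.
  by apply: Num.Theory.truncn_def; rewrite -natr1; apply/andP; split; lra.
by rewrite /fracn E addrAC subrr add0r.
Qed.

Lemma cell_speed_ge0 s : 0 <= s -> 0 <= cell_speed s.
Proof. by move=> /fracn_itv/andP[? ?]; apply: mulr_ge0 => //; lra. Qed.

Lemma cell_speed0 : cell_speed 0 = 0.
Proof. by rewrite /cell_speed /fracn Num.Theory.truncn0 subrr mul0r. Qed.

Lemma cell_speed_le s : 0 <= s -> cell_speed s <= s.
Proof.
move=> s0; have /andP[u0 u1] := fracn_itv s0.
apply: (@le_trans _ _ (fracn s)); first by rewrite /cell_speed ler_piMr ?gerBl.
by rewrite /fracn gerBl ler0n.
Qed.

Lemma cell_speed_lipschitz a b : 0 <= a <= b -> `|cell_speed a - cell_speed b| <= b - a.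
Proof.
move=> /andP[a0 ab]; have b0 := le_trans a0 ab.
have /andP[fa0 fa1] := fracn_itv a0; have /andP[fb0 fb1] := fracn_itv b0.
have ga := cell_speed_ge0 a0; have gb := cell_speed_ge0 b0.
have := Num.Theory.le_truncn ab; rewrite leq_eqVlt => /orP[/eqP E|lt_ab].
  have : b - a = fracn b - fracn a by rewrite /fracn E; ring.
  move=> baE; have : 0 <= fracn b - fracn a by rewrite -baE subr_ge0.
  rewrite baE /cell_speed; move: (fracn a) (fracn b) fa0 fa1 fb0 fb1 => p q p0 p1 q0 q1 pq.
  have h1 : 0 <= (q - p) * (p + q) by apply: mulr_ge0; lra.
  have h2 : 0 <= (q - p) * (2 - p - q) by apply: mulr_ge0; lra.
  by rewrite ler_norml; apply/andP; split; lra.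
have ga' : cell_speed a <= 1 - fracn a by rewrite /cell_speed ler_piMl ?subr_ge0 ?ltW.
have gb' : cell_speed b <= fracn b by rewrite /cell_speed ler_piMr ?gerBl.
have : (Num.truncn a)%:R + 1 <= (Num.truncn b)%:R :> R by rewrite natr1 ler_nat.
rewrite ler_norml; move: ga' gb'; rewrite /fracn => *.
by apply/andP; split; lra.
Qed.

Lemma odd_cell_speedE s : 0 <= s -> odd_cell_speed s = cell_speed s.
Proof.
rewrite le_eqVlt => /predU1P[<-|s0]; rewrite /odd_cell_speed.
  by rewrite sgr0 mul0r cell_speed0.
by rewrite gtr0_sg// mul1r gtr0_norm.
Qed.

Lemma odd_cell_speedN s : odd_cell_speed (- s) = - odd_cell_speed s.
Proof. by rewrite /odd_cell_speed sgrN normrN mulNr. Qed.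

Lemma odd_cell_speed_lipschitz a b : `|odd_cell_speed a - odd_cell_speed b| <= `|a - b|.
Proof.
wlog ab : a b / a <= b.
  move=> H; have /orP[/H//|/H H1] := le_total a b.
  by rewrite distrC [leRHS]distrC.
have [a0|a0] := leP 0 a.
  have b0 := le_trans a0 ab.
  rewrite !odd_cell_speedE// [leRHS]ler0_norm ?subr_le0// opprB.
  by apply: cell_speed_lipschitz; rewrite a0.
have Na0 : 0 <= - a by lra.
have aE : odd_cell_speed a = - cell_speed (- a).
  by rewrite -[a in LHS]opprK odd_cell_speedN odd_cell_speedE.
have [b0|b0] := leP 0 b.
  have := cell_speed_ge0 Na0; have := cell_speed_ge0 b0.
  have := cell_speed_le Na0; have := cell_speed_le b0.
  rewrite aE odd_cell_speedE// => q1 q2 q3 q4.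
  rewrite [leRHS]ler0_norm ?subr_le0// opprB.
  by rewrite ler_norml; apply/andP; split; lra.
rewrite aE -[b in X in `|X|]opprK odd_cell_speedN [odd_cell_speed (- b)]odd_cell_speedE; last lra.
rewrite -opprD normrN [leRHS]ler0_norm ?subr_le0// opprB.
have := @cell_speed_lipschitz (- b) (- a).
by rewrite distrC => H; apply: le_trans (H _) _; lra.
Qed.

Lemma logistic_denom_gt0 t u : 0 <= u < 1 -> 0 < 1 - u + u * expR t.
Proof.
move=> /andP[u0 u1]; have : 0 <= u * expR t by rewrite mulr_ge0 ?expR_ge0.
by lra.
Qed.

Lemma logistic_itv t u : 0 <= u < 1 -> 0 <= logistic t u < 1.
Proof.
move=> u01; have D0 := logistic_denom_gt0 t u01; have /andP[u0 u1] := u01.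
rewrite /logistic subr_ge0 ler_pdivrMr// mul1r gtrBl divr_gt0 ?andbT//; last lra.
by rewrite lerDl mulr_ge0 ?expR_ge0.
Qed.

Lemma is_derive_logistic t u : 0 <= u < 1 ->
  is_derive t (1 : R) (fun s => logistic s u) (logistic t u * (1 - logistic t u)).
Proof.
move=> u01; have D0 := logistic_denom_gt0 t u01.
pose D (s : R) := 1 - u + u * expR s.
have dD : is_derive t (1 : R) D (u * expR t).
  by apply: is_derive_eq; rewrite /GRing.scale /=; ring.
have DN0 : D t != 0 by rewrite gt_eqF.
have dV := is_deriveV DN0 dD.
have -> : (fun s => logistic s u) = (fun s => 1 - (1 - u) * (D s)^-1) by [].
apply: is_derive_eq.
rewrite /logistic -/(D t) /GRing.scale /=.
have -> : u * expR t = D t - (1 - u) by rewrite /D; ring.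
by field.
Qed.

Lemma cell_flow0 s : cell_flow 0 s = s.
Proof.
rewrite /cell_flow /logistic expR0 mulr1 subrK divr1 subKr /fracn addrC subrK.
by rewrite -numEsg.
Qed.

Lemma odd_cell_speed_flow t s :
  odd_cell_speed (cell_flow t s) =
  Num.sg s * (logistic t (fracn `|s|) * (1 - logistic t (fracn `|s|))).
Proof.
have u01 := fracn_itv (normr_ge0 s); have U01 := logistic_itv t u01.
have v0 : 0 <= (Num.truncn `|s|)%:R + logistic t (fracn `|s|).
  by rewrite addr_ge0//; case/andP: U01.
have E : cell_speed ((Num.truncn `|s|)%:R + logistic t (fracn `|s|)) =
    logistic t (fracn `|s|) * (1 - logistic t (fracn `|s|)).
  by rewrite /cell_speed fracnD.
rewrite /cell_flow; move: (_ + _) (logistic _ _ * _) v0 E => v L v0 E.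
case: (sgrP s) => _; rewrite ?mul0r ?mul1r ?mulN1r.
- by rewrite odd_cell_speedE// cell_speed0.
- by rewrite odd_cell_speedE// E.
- by rewrite odd_cell_speedN odd_cell_speedE// E.
Qed.

Lemma is_derive_cell_flow t s :
  is_derive t (1 : R) (fun r => cell_flow r s) (odd_cell_speed (cell_flow t s)).
Proof.
have dl := is_derive_logistic t (fracn_itv (normr_ge0 s)).
rewrite odd_cell_speed_flow /cell_flow.
by apply: is_derive_eq; rewrite /GRing.scale /=; ring.
Qed.

Lemma norm_sg_mul_le s (v : R) : `|Num.sg s * v| <= `|v|.
Proof. by rewrite normrM normr_sg; case: (s != 0); rewrite ?mul1r ?mul0r. Qed.

Lemma cell_flow_close t s : `|cell_flow t s - s| <= 1.
Proof.
have /andP[u0 u1] := fracn_itv (normr_ge0 s).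
have /andP[U0 U1] := logistic_itv t (introT andP (conj u0 u1)).
rewrite {2}[s]numEsg /cell_flow -mulrBr; apply: le_trans (norm_sg_mul_le _ _) _.
have -> : (Num.truncn `|s|)%:R + logistic t (fracn `|s|) - `|s| =
  logistic t (fracn `|s|) - fracn `|s| by rewrite /fracn; ring.
by rewrite ler_norml; apply/andP; split; lra.
Qed.

Lemma cell_limit_close s : `|cell_limit s - s| <= 1.
Proof.
have /andP[u0 u1] := fracn_itv (normr_ge0 s).
rewrite {2}[s]numEsg /cell_limit -mulrBr; apply: le_trans (norm_sg_mul_le _ _) _.
have -> : (Num.truncn `|s|)%:R + (0 < fracn `|s|)%R%:R - `|s| =
  (0 < fracn `|s|)%R%:R - fracn `|s| by rewrite /fracn; ring.
by case: (ltP 0 (fracn `|s|)) => _ /=; rewrite ler_norml; apply/andP; split; lra.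
Qed.

Lemma cell_limit_neq0 s : s != 0 -> cell_limit s != 0.
Proof.
move=> s0; rewrite mulf_neq0 ?sgr_eq0//.
have [u0|u0] := ltP 0 (fracn `|s|); first by rewrite gt_eqF// ltr_wpDl.
rewrite addr0; have /andP[u0' _] := fracn_itv (normr_ge0 s).
have -> : (Num.truncn `|s|)%:R = `|s| :> R by move: u0 u0'; rewrite /fracn => *; lra.
by rewrite normr_eq0.
Qed.

Lemma cell_limit_int s : exists z : int, cell_limit s = z%:~R.
Proof.
rewrite /cell_limit -natrD; move: (_ + _)%N => m; case: (sgrP s) => _.
- by exists 0; rewrite mul0r.
- by exists m; rewrite mul1r.
- by exists (- m%:Z); rewrite mulN1r rmorphN.
Qed.

Lemma logistic_cvg u : 0 <= u < 1 -> logistic n%:R u @[n --> \oo] --> ((0 < u)%R%:R : R).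
Proof.
move=> u01; have /andP[u0 u1] := u01; have [u_gt0|] := ltP 0 u; last first.
  move=> u_le0; have -> : u = 0 by lra.
  have -> : (fun n : nat => logistic n%:R 0) = (fun=> 0 : R).
    by apply/funext => n; rewrite /logistic mul0r subr0 addr0 divr1 subrr.
  exact: cvg_cst.
have H : (1 - u) / (1 - u + u * expR n%:R) @[n --> \oo] --> (0 : R).
  apply: (@squeeze_cvgr _ _ _ _ (fun=> 0) (fun n => u^-1 * harmonic n)).
  - apply: nearW => n; have D0 := logistic_denom_gt0 n%:R u01.
    rewrite divr_ge0 ?(ltW D0)//=; last lra.
    rewrite -invfM; apply: le_trans (_ : _ <= 1 / (u * n.+1%:R)) _; last by rewrite mul1r.
    have un0 : 0 < u * n.+1%:R by rewrite mulr_gt0.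
    rewrite ler_pdivrMr// mulrAC ler_pdivlMr// mul1r.
    have : u * n.+1%:R <= u * expR n%:R.
      by rewrite ler_wpM2l// -nat1r; exact: expR_ge1Dx.
    by move: (u * _) (u * _) un0 => p q p0 pq; nra.
  - exact: cvg_cst.
  - by rewrite -(mulr0 u^-1); apply: cvgMl_tmp; exact: cvg_harmonic.
by rewrite /= -[X in _ --> X]subr0; apply: cvgB => //; exact: cvg_cst.
Qed.

Lemma cell_flow_cvg s : cell_flow n%:R s @[n --> \oo] --> cell_limit s.
Proof.
apply: cvgMl_tmp; apply: cvgD; first exact: cvg_cst.
exact: logistic_cvg (fracn_itv (normr_ge0 s)).
Qed.

Lemma measurable_cell_flow t : measurable_fun [set: measurableTypeR R]
  (fun s => cell_flow t s : measurableTypeR R).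
Proof.
have mnorm : measurable_fun [set: measurableTypeR R] (fun s => `|s| : measurableTypeR R).
  by apply: continuous_measurable_fun; exact: norm_continuous.
have mtr : measurable_fun [set: measurableTypeR R]
    (fun s => (Num.truncn `|s|)%:R : measurableTypeR R).
  apply: (measurableT_comp (f := fun s : measurableTypeR R =>
    (Num.truncn s)%:R : measurableTypeR R)) mnorm.
  by apply: nondecreasing_measurable => // a b ab; rewrite ler_nat Num.Theory.le_truncn.
have msg : measurable_fun [set: measurableTypeR R] (fun s => Num.sg s : measurableTypeR R).
  apply: nondecreasing_measurable => // a b ab.
  by case: (sgrP a) => ha; case: (sgrP b) => hb; lra.
have mfr : measurable_fun [set: measurableTypeR R] (fun s => fracn `|s| : measurableTypeR R).
  exact: measurable_funB.
apply: measurable_funM => //; apply: measurable_funD => //.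
have -> : (fun s => logistic t (fracn `|s|)) =
    (fun s => 1 - (1 - fracn `|s|) * (1 - fracn `|s| + fracn `|s| * expR t) `^ (-1)).
  apply/funext => s; rewrite powR_inv1//.
  by apply/ltW/logistic_denom_gt0/fracn_itv.
apply: measurable_funB => //; apply: measurable_funM; first exact: measurable_funB.
apply: (measurableT_comp (measurable_powR (-1))).
by apply: measurable_funD; [exact: measurable_funB|exact: measurable_funM].
Qed.

End Logistic.

Section Contraction.
Context {R : realType} {d : nat}.
Implicit Types (x y : 'rV[R]_d).

Definition cell_contraction (h : R) x : 'rV[R]_d := \row_i (h * odd_cell_speed (x 0 i / h)).

Definition contraction_flow (h t : R) x : 'rV[R]_d := \row_i (h * cell_flow t (x 0 i / h)).

Definition contraction_limit (h : R) x : 'rV[R]_d := \row_i (h * cell_limit (x 0 i / h)).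

Lemma contraction_lipschitz h : lipschitz_field 1 (cell_contraction h).
Proof.
move=> x y; rewrite mul1r; apply: norm_row_le => // i; rewrite !mxE.
apply: le_trans (norm_coord (x - y) i); rewrite !mxE -mulrBr normrM.
have [->|h0] := eqVneq h 0; first by rewrite normr0 mul0r.
apply: (@le_trans _ _ (`|h| * `|x 0 i / h - y 0 i / h|)).
  by rewrite ler_wpM2l// odd_cell_speed_lipschitz.
by rewrite -mulrBl normrM normfV mulrCA mulfV ?mulr1// normr_eq0.
Qed.

Lemma odd_cell_speed0 : odd_cell_speed 0 = 0 :> R.
Proof. by rewrite /odd_cell_speed sgr0 mul0r. Qed.

Lemma contraction_flowP h t S : h != 0 -> 0 <= t ->
  flow_on (cell_contraction h) t S (contraction_flow h t).
Proof.
move=> h0 t0; split=> // x _; exists (fun s => contraction_flow h s x).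
have dy s : is_derive s (1 : R) (fun s => contraction_flow h s x)
    (cell_contraction h (contraction_flow h s x)).
  apply: is_derive_row => i.
  have -> : (fun s => contraction_flow h s x 0 i) = (fun s => h * cell_flow s (x 0 i / h)).
    by apply/funext => r; rewrite mxE.
  have dc := is_derive_cell_flow s (x 0 i / h).
  by apply: is_derive_eq; rewrite !mxE mulrAC divff// mul1r /GRing.scale /=; ring.
split => //.
- by apply/rowP => i; rewrite mxE cell_flow0 mulrC divfK.
- exact/continuous_subspaceT/(is_derive_row_continuous dy).
Qed.

Lemma zero_of_derive_le (f df : R -> R) (t : R) : 0 <= t ->
  {within `[0, t], continuous f} -> f 0 = 0 ->
  (forall s, 0 < s < t -> is_derive s (1 : R) f (df s)) ->
  (forall s, `|df s| <= `|f s|) -> f t = 0.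
Proof.
rewrite le_eqVlt => /predU1P[<-//|t0] cf f0 fd dfle.
pose w (s : R) := f s * f s * expR (- 2 * s).
pose dw (s : R) := 2 * (f s * df s - f s * f s) * expR (- 2 * s).
have dexp (s : R) : is_derive s (1 : R) (fun s => expR (- 2 * s)) (- 2 * expR (- 2 * s)).
  have dl : is_derive s (1 : R) (fun r : R => - 2 * r) (- 2).
    by apply: is_derive_eq; rewrite /GRing.scale /=; ring.
  rewrite mulrC -[X in _ * X]/(- 2 : R).
  exact: (@is_derive1_comp R expR (fun r : R => - 2 * r) s _ _ _ dl).
have dw' s : s \in `]0, t[ -> is_derive s (1 : R) w (dw s).
  rewrite in_itv => /fd dfs.
  by apply: is_derive_eq; rewrite /dw /GRing.scale /=; ring.
have cw : {within `[0, t], continuous w}.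
  move=> z; apply: (@continuousM R (subspace `[0, t]%classic) (fun s => f s * f s)
    (fun s => expR (- 2 * s))).
    by apply: (@continuousM R (subspace `[0, t]%classic) f f); exact: cf.
  apply: (@continuous_subspaceT _ _ _ (fun s : R => expR (- 2 * s))) => {}z.
  by apply: differentiable_continuous; apply/derivable1_diffP; have [] := dexp z.
have [c _] := MVT t0 dw' cw.
have dwc : dw c <= 0.
  rewrite /dw pmulr_lle0 ?expR_gt0//.
  have := ler_norm (f c * df c); rewrite normrM => H.
  have : `|f c| * `|df c| <= `|f c| * `|f c| by rewrite ler_wpM2l.
  have -> : `|f c| * `|f c| = f c * f c by rewrite -normrM ger0_norm// -expr2 sqr_ge0.
  by move=> H1; lra.
rewrite {2}/w f0 !mul0r subr0 => wE.
have : w t <= 0 by rewrite wE subr0 mulr_le0_ge0// ltW.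
rewrite /w pmulr_lle0 ?expR_gt0// => ff.
have : f t * f t = 0 by apply/le_anti; rewrite ff -expr2 sqr_ge0.
by move/eqP; rewrite mulf_eq0 orbb => /eqP.
Qed.

Lemma contraction_fixes_origin h t S phi :
  flow_on (cell_contraction h) t S phi -> S 0 -> phi 0 = 0.
Proof.
move=> [t0 fl] /fl[y [y0 cy dy ->]]; apply/rowP => i; rewrite mxE.
apply: (@zero_of_derive_le (fun s => y s 0 i) (fun s => cell_contraction h (y s) 0 i)) => //.
- move=> z; apply: (@continuous_comp (subspace `[0, t]%classic) _ _ y
    (fun M : 'rV[R]_d => M 0 i) z (cy z)).
  exact: coord_continuous.
- by rewrite y0 mxE.
- by move=> s /dy /(is_derive_coord i).
- move=> s; rewrite mxE; have [->|h0] := eqVneq h 0; first by rewrite mul0r normr0.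
  have := odd_cell_speed_lipschitz (y s 0 i / h) 0.
  have -> : `|y s 0 i / h - 0| = `|y s 0 i| / `|h| by rewrite subr0 normrM normfV.
  rewrite odd_cell_speed0 subr0 ler_pdivlMr ?normr_gt0// => H.
  by rewrite normrM mulrC.
Qed.

Lemma preserves_measurable_contraction_flow h t :
  preserves_measurable (contraction_flow h t).
Proof.
move=> d' T u mu i; under eq_fun do rewrite mxE.
apply: measurable_funM => //; apply: (measurableT_comp (measurable_cell_flow t)).
by apply: measurable_funM; [exact: mu|exact: measurable_cst].
Qed.

Lemma contraction_flow_cvg h x :
  contraction_flow h n%:R x @[n --> \oo] --> contraction_limit h x.
Proof.
apply: cvg_row => i; rewrite mxE; under eq_fun do rewrite mxE.
apply: cvgMl_tmp; exact: cell_flow_cvg.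
Qed.

Lemma scaled_close (h v : R) (f : R -> R) : 0 < h -> (forall s, `|f s - s| <= 1) ->
  `|h * f (v / h) - v| <= h.
Proof.
move=> h0 fs; have -> : h * f (v / h) - v = h * (f (v / h) - v / h).
  by rewrite mulrBr mulrCA divff ?mulr1// gt_eqF.
by rewrite normrM gtr0_norm// ler_piMr// ltW.
Qed.

End Contraction.

(** * Approximation *)

Section CompactBounds.
Context {R : realType} {d : nat}.
Implicit Types (x y : 'rV[R]_d) (F G : 'rV[R]_d -> 'rV[R]_d).

Lemma eucl_norm_le (v : 'rV[R]_d) (c : R) : `|v| <= c -> eucl_norm v <= d%:R * c.
Proof.
move=> vc; have c0 : 0 <= c by exact: le_trans vc.
rewrite -[leRHS]ger0_norm ?mulr_ge0// -sqrtr_sqr ler_wsqrtr//.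
apply: (@le_trans _ _ (\sum_(i < d) c ^+ 2)).
  apply: ler_sum => i _; rewrite -real_normK ?num_real// lerXn2r ?nnegrE//.
  exact: le_trans (norm_coord v i) vc.
rewrite sumr_const card_ord -[leLHS]mulr_natl exprMn ler_wpM2r ?sqr_ge0//.
rewrite -natrX ler_nat; case: (d) => // k; exact: leq_pmulr.
Qed.

Lemma bounded_on_compact G (K : set 'rV[R]_d) : continuous G -> compact K ->
  exists2 M, 0 <= M & forall x, K x -> `|G x| <= M.
Proof.
move=> cG cK; have := continuous_compact (continuous_subspaceT cG) cK.
move=> /compact_bounded[M [_ HM]]; exists (`|M| + 1) => [|x Kx].
  by rewrite addr_ge0.
apply: (HM (`|M| + 1)); last by exists x.
by apply: le_lt_trans (ler_norm M) _; rewrite ltrDl.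
Qed.

Lemma compact_sub_box (K : set 'rV[R]_d) : compact K ->
  exists2 B, 1 <= B & K `<=` box B.
Proof.
move=> /(bounded_on_compact (G := id))[|M M0 HM]; first by move=> x; exact: cvg_id.
exists (M + 1) => [|x /HM xM j]; first by rewrite lerDr.
by apply: le_trans (norm_coord x j) _; apply: le_trans xM _; rewrite lerDl.
Qed.

Lemma uniform_continuity_on_compact F (K : set 'rV[R]_d) (e : R) :
  continuous F -> compact K -> 0 < e ->
  exists2 h, 0 < h & forall x y, K x -> `|x - y| <= h -> `|F x - F y| <= e.
Proof.
move=> cF cK e0.
have := (compact_near_coveringP K).1 cK R (0^'+)
  (fun h x => forall y, `|x - y| <= h -> `|F x - F y| <= e) _.
move=> /(_ _)[|h0 /= h0_gt0 H].
  move=> x _; have e2 : 0 < e / 2 by exact: divr_gt0.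
  have := (@cvgrPdist_le R _ _ (nbhs x) (nbhs_filter x) F (F x)).1 (cF x) _ e2.
  move=> /nbhs_ballP[r /= r0 Hr]; have r2 : 0 < r / 2 by exact: divr_gt0.
  exists (ball x (r / 2), [set h | 0 < h < r / 2]) => /=.
    split; first exact: nbhsx_ballx.
    near=> h; apply/andP; split; near: h; [exact: nbhs_right_gt|exact: nbhs_right_lt].
  move=> [z h] /= [xz /andP[hp hr]] y zy.
  have zB : ball x r z by apply: le_ball xz; rewrite ler_pdivrMr// ler_peMr ?ler1n ?ltW.
  have yB : ball x r y.
    rewrite (splitr r); apply: ball_triangle xz _.
    apply/ball_rowP; split=> // j.
    have := norm_coord (z - y) j; rewrite !mxE => zyj.
    exact: le_lt_trans (le_trans zyj zy) hr.
  rewrite (splitr e) -(subrKA (F x)); apply: le_trans (ler_normD _ _) _.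
  by rewrite lerD ?Hr// distrC Hr.
exists (h0 / 2); first exact: divr_gt0.
move=> x y Kx; apply: H => //=; last exact: divr_gt0.
by rewrite sub0r normrN gtr0_norm ?divr_gt0// ltr_pdivrMr// ltr_pMr// ltr1n.
Unshelve. all: by end_near. Qed.

End CompactBounds.

Section UniversalApproximation.
Context {R : realType} {n : nat}.
Local Notation d := n.+2.
Implicit Types (x y : 'rV[R]_d) (F : 'rV[R]_d -> 'rV[R]_d).

Lemma injective_perturbation (J : finType) (vs : J -> 'rV[R]_d) (e : R) : 0 < e ->
  exists ys : J -> 'rV[R]_d, [/\ injective ys, forall m, ys m != 0 &
    forall m, `|vs m - ys m| <= e].
Proof.
move=> e0.
pose q (mk : J * J) : {poly R} := if mk.1 == mk.2
  then (vs mk.1 0 0)%:P + (enum_rank mk.1).+1%:R *: 'X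
  else (vs mk.1 0 0 - vs mk.2 0 0)%:P +
    ((enum_rank mk.1).+1%:R - (enum_rank mk.2).+1%:R) *: 'X.
have q0 mk : q mk != 0.
  case: mk => m k; apply/negP => /eqP/(congr1 (fun r : {poly R} => r`_1)); rewrite /q /=.
  case: (eqVneq m k) => [_|mk]; rewrite coefD coefC coefZ coefX /= mulr1 add0r coef0 => /eqP.
    by rewrite pnatr_eq0.
  by rewrite subr_eq0 eqr_nat eqSS => /eqP/val_inj/enum_rank_inj/eqP; rewrite (negbTE mk).
have e1 : 0 < e / #|J|.+1%:R by rewrite divr_gt0// ltr0n.
have prod0 : \prod_mk q mk != 0 by apply/prodf_neq0 => mk _; exact: q0.
have [c /andP[c0 cle] nr] := small_nonroot prod0 e1.
have qN0 mk : (q mk).[c] != 0.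
  by apply: contra nr => E; rewrite (bigD1 mk)//= rootM /root E.
exists (fun m => vs m + (c * (enum_rank m).+1%:R) *: delta_mx 0 0); split=> [m k|m|m].
- move=> /rowP/(_ 0); rewrite !mxE eqxx !mulr1 => E; apply/eqP; apply: contraT => mk.
  have := qN0 (m, k); rewrite /q /= (negbTE mk) hornerD hornerC hornerZ hornerX.
  by rewrite mulrBl ![_ * c]mulrC addrACA -opprD E subrr eqxx.
- have := qN0 (m, m); rewrite /q /= eqxx hornerD hornerC hornerZ hornerX mulrC.
  by apply: contra => /eqP/rowP/(_ 0); rewrite !mxE eqxx mulr1 => ->.
- rewrite opprD addNKr normrN normrZ.
  apply: (@le_trans _ _ (c * (enum_rank m).+1%:R * 1)).
    rewrite ger0_norm ?mulr_ge0 ?(ltW c0)// ler_wpM2l ?mulr_ge0 ?(ltW c0)//.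
    by apply: norm_row_le => // j; rewrite mxE; case: (_ && _); rewrite ?normr0 ?normr1.
  rewrite mulr1; apply: (@le_trans _ _ (c * #|J|.+1%:R)).
    by rewrite ler_wpM2l ?(ltW c0)// ler_nat ltnS ltnW.
  by rewrite -ler_pdivlMr ?ltr0n// ltW.
Qed.

Lemma contraction_limit_finite (h B : R) : 0 < h ->
  exists (J : finType) (pt : J -> 'rV[R]_d), [/\ injective pt, forall g, pt g != 0 &
    forall x, box B x -> contraction_limit h x != 0 ->
      exists g, pt g = contraction_limit h x].
Proof.
move=> h0; pose M := (Num.truncn ((`|B| + h) / h)).+1.
pose J0 := {ffun 'I_d -> 'I_(M + M).+1}.
pose pt0 (g : J0) : 'rV[R]_d := \row_j (h * ((g j : nat)%:R - M%:R)).
have pt0_inj : injective pt0.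
  move=> g g' /rowP E; apply/ffunP => j; have := E j; rewrite !mxE.
  by move=> /(mulfI (lt0r_neq0 h0)) /addIr /eqP; rewrite eqr_nat => /eqP/val_inj.
exists {g : J0 | pt0 g != 0}, (fun g => pt0 (val g)); split.
- by move=> g g' /pt0_inj/val_inj.
- by move=> g; exact: (valP g).
move=> x xB cx0.
have /choice[z zP] : forall j : 'I_d, exists k : 'I_(M + M).+1,
    contraction_limit h x 0 j = h * ((k : nat)%:R - M%:R).
  move=> j; have [z zE] := cell_limit_int (x 0 j / h).
  have : `|h * cell_limit (x 0 j / h)| < h * M%:R.
    apply: (@le_lt_trans _ _ (`|B| + h)).
      have := scaled_close (x 0 j) h0 (@cell_limit_close R) => H.
      rewrite -[X in `|X|](subrK (x 0 j)) addrC; apply: le_trans (ler_normD _ _) _.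
      by rewrite lerD//; apply: le_trans (xB j) (ler_norm B).
    by rewrite mulrC -ltr_pdivrMr//; exact: Num.Theory.truncnS_gt.
  rewrite zE normrM gtr0_norm// ltr_pM2l// -intr_norm => zM.
  have zM' : (`|z| < M%:Z)%R by move: zM; rewrite -(ltr_int R).
  have kM : (`|(z + M%:Z)%R|%N < (M + M).+1)%N by lia.
  exists (Ordinal kM); rewrite mxE zE /=; congr (_ * _).
  have -> : (`|(z + M%:Z)%R|%N)%:R = (z + M%:Z)%:~R :> R.
    by rewrite -[LHS]/((`|(z + M%:Z)%R|%N)%:Z%:~R); congr (_%:~R); lia.
  by rewrite rmorphD /= addrK.
pose g0 : J0 := [ffun j => z j].
have g0E : pt0 g0 = contraction_limit h x.
  by apply/rowP => j; rewrite mxE ffunE zP.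
have g0N : pt0 g0 != 0 by rewrite g0E.
by exists (exist _ g0 g0N).
Qed.

Lemma poweR_inv_lt (I : \bar R) (p eps : R) : 0 < p -> 0 < eps -> (0 <= I)%E ->
  (I < (eps `^ p)%:E)%E -> (I `^ p^-1 < eps%:E)%E.
Proof.
move=> p0 eps0; case: I => [r| |] //; rewrite !lee_fin !lte_fin => r0 rlt.
rewrite ?poweR_EFin ?lte_fin -[ltRHS]powRr1 ?(ltW eps0)// -(mulfV (lt0r_neq0 p0)) powRrM.
by apply: gt0_ltr_powR; rewrite ?invr_gt0// nnegrE ?powR_ge0.
Qed.

(* Pointwise convergence off a hyperplane, with uniform bounds, to within [eta]
   of the target suffices: the maximum with [eta `^ p] converges everywhere. *)
Lemma Lp_dist_eventually_small (p : R) (K : set 'rV[R]_d) F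
    (phi : nat -> 'rV[R]_d -> 'rV[R]_d) (B M eta eps : R) :
  0 < p -> 0 < eps -> 0 <= B -> 0 <= M -> 0 <= eta -> compact K -> K `<=` box B ->
  continuous F -> (forall k, preserves_measurable (phi k)) ->
  (forall k x, K x -> eucl_norm (F x - phi k x) <= M) ->
  (forall x, K x -> x 0 0 != 0 ->
     \forall k \near \oo, eucl_norm (F x - phi k x) <= eta) ->
  eta `^ p * (2 * B) ^+ d < eps `^ p ->
  exists k, (Lp_dist p K F (phi k) < eps%:E)%E.
Proof.
move=> p0 eps0 B0 M0 eta0 cK KB cF mphi phiM phieta small.
have clK : closed K by apply: compact_closed; [exact: norm_hausdorff|exact: cK].
pose h k x : \bar R := ((\1_K x : R) * eucl_norm (F x - phi k x) `^ p)%:E.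
have h0 k x : (0 <= h k x)%E by rewrite lee_fin mulr_ge0 ?powR_ge0// indicE ler0n.
have mh k : test_measurable (h k) by exact: test_measurable_Lp_integrand.
pose H : set 'rV[R]_d := [set x | x 0 0 = 0].
have clH : closed H.
  apply: (@closed_comp _ _ (fun x : 'rV[R]_d => x 0 0) [set 0 : R]).
    by move=> x _; exact: coord_continuous.
  exact: closed_eq.
pose h' k x : \bar R := ((1 - \1_H x)%:E * h k x)%E.
have h'0 k x : (0 <= h' k x)%E.
  by rewrite mule_ge0// lee_fin subr_ge0 indicE lern1 leq_b1.
have mh' k : test_measurable (h' k).
  move=> d' T u mu; apply: emeasurable_funM; last exact: mh.
  by apply/measurable_EFinP; apply: measurable_funB => //; exact: measurable_indic_closed.
have hh' k : integral_Rd (h k) = integral_Rd (h' k).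
  apply: (@integral_Rd_eq_off_hyperplane R d 0) => // x x0.
  by rewrite /h' indicE memNset ?subr0 ?mul1e//; exact/eqP.
pose b := box_step (d := d) B (eta `^ p) 0.
have b0 x : (0 <= b x)%E by apply: box_step_ge0; rewrite ?powR_ge0.
have mb : test_measurable b by exact: test_measurable_box_step.
pose g k x : \bar R := maxe (h' k x) (b x).
have mg k : test_measurable (g k).
  by move=> d' T u mu; apply: measurable_maxe; [exact: mh'|exact: mb].
have hle k x : (h k x <= box_step B (M `^ p) 0 x)%E.
  rewrite box_step0E lee_fin [\1_K x]indicE; case: (boolP (x \in K)) => [|_].
    rewrite inE => Kx; rewrite mul1r indicE mem_set ?mulr1; last exact: KB.
    by apply: ge0_ler_powR; rewrite ?nnegrE ?sqrtr_ge0 ?(ltW p0)//; exact: phiM.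
  by rewrite mul0r mulr_ge0 ?powR_ge0// indicE ler0n.
have h'le k x : (h' k x <= h k x)%E.
  rewrite /h' -[leRHS]mul1e lee_wpmul2r// lee_fin gerBl indicE; exact: ler0n.
have cvg_g : integral_Rd (g k) @[k --> \oo] --> integral_Rd b.
  pose C := M `^ p + eta `^ p.
  have C0 : 0 <= C by rewrite addr_ge0 ?powR_ge0.
  apply: (@dominated_convergence_Rd R d g b B C) => //.
  - by move=> k x; rewrite le_max b0 orbT.
  - move=> k x; rewrite ge_max; apply/andP; split.
      apply: (le_trans (h'le k x)); apply: (le_trans (hle k x)).
      by rewrite !box_step0E lee_fin ler_wpM2r ?indicE ?ler0n// lerDl powR_ge0.
    by rewrite /b !box_step0E lee_fin ler_wpM2r ?indicE ?ler0n// lerDr powR_ge0.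
  - move=> x; suff : \forall k \near \oo, (h' k x <= b x)%E.
      move=> hb; apply: cvg_near_cst.
      by apply: filterS hb => k hkb; apply/max_idPr.
    have [x0|x0] := eqVneq (x 0 0) 0.
      by apply: nearW => k; rewrite /h' indicE mem_set// subrr mul0e.
    have [Kx|nKx] := pselect (K x); last first.
      by apply: nearW => k; apply: le_trans (h'le k x) _; rewrite /h indicE memNset// mul0r.
    apply: filterS (phieta x Kx x0) => k hk; apply: le_trans (h'le k x) _.
    rewrite /h /b box_step0E lee_fin !indicE !mem_set//; last exact: KB.
    by rewrite mul1r mulr1; apply: ge0_ler_powR; rewrite ?nnegrE ?sqrtr_ge0 ?(ltW p0).
have Ib : (integral_Rd b < (eps `^ p)%:E)%E by rewrite integral_Rd_box_step ?powR_ge0.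
have : \forall k \near \oo, (integral_Rd (g k) < (eps `^ p)%:E)%E.
  exact: (cvg_g _ (open_ereal_lt' Ib)).
move=> [k _ /(_ k (leqnn k)) /= gk]; exists k.
apply: poweR_inv_lt => //; first exact: (iter_integral_ge0 _ _ (h0 k)).
rewrite -/(h k) hh'; apply: le_lt_trans gk; apply: iter_integral_le => // x.
by rewrite le_max lexx.
Qed.

Lemma contraction_rich_universal_approximation (p : R)
    (Fam : set ('rV[R]_d -> 'rV[R]_d)) :
  1 <= p -> shear_rich Fam -> (forall h, h != 0 -> Fam (cell_contraction h)) ->
  universal_approximation_Lp p Fam.
Proof.
move=> p1 rich Fc F cF K cK eps eps0.
have p0 : 0 < p by exact: lt_le_trans p1.
have [B B1 KB] := compact_sub_box cK.
have B0 : 0 < B by exact: lt_le_trans B1.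
have V0 : 0 < (2 * B) ^+ d by rewrite exprn_gt0// mulr_gt0.
pose eta := (eps `^ p / (2 * (2 * B) ^+ d)) `^ p^-1.
have eta0 : 0 < eta by rewrite powR_gt0// divr_gt0 ?powR_gt0// mulr_gt0.
have etaV : eta `^ p * (2 * B) ^+ d < eps `^ p.
  rewrite /eta -powRrM mulVf ?gt_eqF// powRr1; last first.
    by rewrite divr_ge0 ?powR_ge0//; apply: mulr_ge0 => //; exact: ltW.
  have e0 : 0 < eps `^ p by rewrite powR_gt0.
  have -> : eps `^ p / (2 * (2 * B) ^+ d) * (2 * B) ^+ d = eps `^ p / 2.
    by move: (_ ^+ d) V0 => V V0; field; rewrite gt_eqF.
  by lra.
pose e1 := eta / (3 * d%:R).
have e10 : 0 < e1 by rewrite divr_gt0// mulr_gt0// ltr0n.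
have [h' h'0 Hunif] := uniform_continuity_on_compact cF cK e10.
pose h := Num.min h' 1.
have h0 : 0 < h by rewrite lt_min h'0 ltr01.
have hh' : h <= h' by rewrite ge_min lexx.
have [J [pt [ptinj pt0 ptP]]] := contraction_limit_finite B h0.
have [ys [yinj y0 yclose]] := injective_perturbation (fun m => F (pt m)) e10.
have [phi2 [rphi2 cphi2] phi2E] := continuous_reach_interpolation rich ptinj yinj pt0 y0.
have [M1 M10 FM] := bounded_on_compact cF (@compact_box R d B).
have [M2 M20 phi2M] := bounded_on_compact cphi2 (@compact_box R d (B + h)).
pose phi k := phi2 \o contraction_flow h k%:R.
have limit_close x : `|x - contraction_limit h x| <= h.
  apply: norm_row_le => [|j]; first exact: ltW.
  by rewrite !mxE distrC; apply: scaled_close => // s; exact: cell_limit_close.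
suff [k Hk] : exists k, (Lp_dist p K F (phi k) < eps%:E)%E.
  exists (phi k); split=> //; apply: attainable_reach rphi2.
  by apply: att_flow (Fc h _) (contraction_flowP _ _ _); rewrite ?gt_eqF.
apply: (@Lp_dist_eventually_small p K F phi B (d%:R * (M1 + M2)) eta eps) => //.
- exact: ltW.
- by rewrite mulr_ge0// addr_ge0.
- exact: ltW.
- move=> k d' T u mu; apply: (preserves_measurable_continuous cphi2).
  exact: preserves_measurable_contraction_flow.
- move=> k x Kx; apply: eucl_norm_le; apply: le_trans (ler_normB _ _) _.
  rewrite lerD// ?FM//; first exact: KB.
  apply: phi2M => j; rewrite mxE.
  have := scaled_close (x 0 j) h0 (@cell_flow_close R k%:R) => H.
  rewrite -[X in `|X|](subrK (x 0 j)) addrC; apply: le_trans (ler_normD _ _) _.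
  by rewrite lerD//; exact: KB.
- move=> x Kx x0.
  have c0 : contraction_limit h x != 0.
    apply: contra x0 => /eqP/rowP/(_ 0); rewrite !mxE => /eqP.
    rewrite mulf_eq0 gt_eqF//=; apply: contraTT => x0.
    by apply: cell_limit_neq0; rewrite mulf_neq0// invr_eq0 gt_eqF.
  have [m ptm] := ptP x (KB x Kx) c0.
  have cvg_phi : phi k x @[k --> \oo] --> ys m.
    rewrite -phi2E ptm.
    apply: (@cvg_comp _ _ _ (fun k => contraction_flow h k%:R x) phi2 \oo
      (nbhs (contraction_limit h x))); last exact: cphi2.
    exact: contraction_flow_cvg.
  have := (@cvgrPdist_le R 'rV[R]_d nat \oo _ (fun k => phi k x) (ys m)).1 cvg_phi _ e10.
  move=> /(_ eventually_filter); apply: filterS => k yk.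
  have -> : eta = d%:R * (e1 + e1 + e1).
    by rewrite /e1; field; rewrite gt_eqF// ltr0n.
  apply: eucl_norm_le.
  have -> : F x - phi k x = (F x - F (pt m)) + (F (pt m) - ys m) + (ys m - phi k x).
    by rewrite -addrA !subrKA.
  apply: le_trans (ler_normD _ _) _; rewrite lerD//.
  apply: le_trans (ler_normD _ _) _; rewrite lerD//.
  by apply: Hunif => //; rewrite ptm; exact: le_trans (limit_close x) hh'.
Qed.

End UniversalApproximation.

(** * The two systems *)

Section Systems.
Context {R : realType} {n : nat}.
Local Notation d := n.+2.
Implicit Types (x u w : 'rV[R]_d).

Definition encode w u (c0 b r h : R) : 'rV[R]_(d + (d + 4)) :=
  row_mx w (row_mx u (\row_(k < 4) [:: c0; b; r; h]`_k)).

(* The last parameter selects the field: [0] stands for a shear, any other value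
   for the contraction towards the grid of that mesh. *)
Definition system x (theta : 'rV[R]_(d + (d + 4))) : 'rV[R]_d :=
  let p k := rsubmx (rsubmx theta) 0 (inord k) in
  if p 3 == 0 then shear (lsubmx theta) (lsubmx (rsubmx theta)) (p 0%N) (p 1%N) (p 2) x
  else cell_contraction (p 3) x.

Lemma system_shear x w u c0 b r : system x (encode w u c0 b r 0) = shear w u c0 b r x.
Proof. by rewrite /system /encode !row_mxKr !row_mxKl !mxE !inordK //= eqxx. Qed.

Lemma system_contraction x (h : R) : h != 0 ->
  system x (encode 0 0 0 0 0 h) = cell_contraction h x.
Proof. by move=> h0; rewrite /system /encode !row_mxKr !mxE !inordK //= (negbTE h0). Qed.

Definition all_shears : set 'rV[R]_(d + (d + 4)) :=
  [set theta | exists i c u c0 b r,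
    u 0 i = 0 /\ theta = encode (c *: delta_mx 0 i) u c0 b r 0].

Definition origin_fixing_fields : set 'rV[R]_(d + (d + 4)) :=
  [set theta | (exists i c u c0 b r,
      [/\ u 0 i = 0, r <= `|b| & theta = encode (c *: delta_mx 0 i) u c0 b r 0]) \/
    (exists2 h, h != 0 & theta = encode 0 0 0 0 0 h)].

Lemma all_shearsP g : control_family all_shears system g <->
  exists i c u c0 b r, u 0 i = 0 /\ g = shear (c *: delta_mx 0 i) u c0 b r.
Proof.
split=> [[_ [i [c [u [c0 [b [r [ui ->]]]]]]] <-]|[i [c [u [c0 [b [r [ui ->]]]]]]]].
  exists i, c, u, c0, b, r; split=> //; apply/funext => x; exact: system_shear.
exists (encode (c *: delta_mx 0 i) u c0 b r 0); first by exists i, c, u, c0, b, r.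
by apply/funext => x; exact: system_shear.
Qed.

Lemma origin_fixing_fieldsP g : control_family origin_fixing_fields system g <->
  (exists i c u c0 b r, [/\ u 0 i = 0, r <= `|b| & g = shear (c *: delta_mx 0 i) u c0 b r]) \/
  (exists2 h, h != 0 & g = cell_contraction h).
Proof.
split=> [[_ [[i [c [u [c0 [b [r [ui rb ->]]]]]]]|[h h0 ->]] <-]|
    [[i [c [u [c0 [b [r [ui rb ->]]]]]]]|[h h0 ->]]].
- left; exists i, c, u, c0, b, r; split=> //; apply/funext => x; exact: system_shear.
- by right; exists h => //; apply/funext => x; exact: system_contraction.
- exists (encode (c *: delta_mx 0 i) u c0 b r 0); first by left; exists i, c, u, c0, b, r.
  by apply/funext => x; exact: system_shear.
- exists (encode 0 0 0 0 0 h); first by right; exists h.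
  by apply/funext => x; exact: system_contraction.
Qed.

Lemma control_system_system (Theta : set 'rV[R]_(d + (d + 4))) : control_system Theta system.
Proof.
move=> theta _; rewrite /system /=; case: (_ 0 (inord 3) == 0).
  by have [L _ /lipschitz_field_locally] := shear_lipschitz
    (lsubmx theta) (lsubmx (rsubmx theta)) (rsubmx (rsubmx theta) 0 (inord 0%N))
    (rsubmx (rsubmx theta) 0 (inord 1%N)) (rsubmx (rsubmx theta) 0 (inord 2)).
exact: (lipschitz_field_locally (@contraction_lipschitz R d _)).
Qed.

Lemma all_shears_rich : shear_rich (control_family all_shears system).
Proof.
split=> [c i u ui|c i j b r ij _]; apply/all_shearsP.
  by exists i, c, u, 1, 0, 0.
exists i, c, (delta_mx 0 j), 0, b, r; split=> //.
by rewrite mxE (negbTE ij) andbF.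
Qed.

Lemma origin_fixing_fields_rich : shear_rich (control_family origin_fixing_fields system).
Proof.
split=> [c i u ui|c i j b r ij /andP[_ rb]]; apply/origin_fixing_fieldsP; left.
  by exists i, c, u, 1, 0, 0; split=> //; rewrite normr0.
exists i, c, (delta_mx 0 j), 0, b, r; split=> //.
by rewrite mxE (negbTE ij) andbF.
Qed.

Lemma reach_translation (c : R) :
  reach (control_family all_shears system) (fun x => x + c *: delta_mx 0 0).
Proof.
have Fg : control_family all_shears system (shear (c *: delta_mx 0 0) 0 0 0 1).
  by apply/all_shearsP; exists 0, c, 0, 0, 0, 1; rewrite mxE.
apply: (reach_flow (t := 1) Fg).
have -> : (fun x => x + c *: delta_mx 0 0) =
    (fun x => x + 1 *: shear (c *: delta_mx 0 0) 0 0 0 1 x).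
  apply/funext => x; rewrite scale1r /shear /ridge.
  have -> : dotr 0 x = 0 by rewrite /dotr big1// => j _; rewrite mxE mul0r.
  rewrite mul0r add0r subr0 normr0 subr0 (_ : Num.max 0 1 = 1) ?scale1r//.
  by apply/max_idPr.
by apply: shear_flow => //; rewrite dotr_delta mxE mulr0.
Qed.

Lemma all_shears_interpolation :
  exact_universal_interpolation (control_family all_shears system).
Proof.
move=> N xs ys xinj yinj.
pose s : R := 1 + \sum_i (`|xs i 0 0| + `|ys i 0 0|).
have s_gt i : `|xs i 0 0| + `|ys i 0 0| < s.
  rewrite /s (bigD1 i)//= addrCA ltrDl.
  by rewrite ltr_wpDr// sumr_ge0// => j _; exact: addr_ge0.
have shift_neq0 (v : 'rV[R]_d) : `|v 0 0| < s -> v + s *: delta_mx 0 0 != 0.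
  apply: contraTN => /eqP/rowP/(_ 0); rewrite !mxE !eqxx mulr1 => /eqP.
  by rewrite addr_eq0 => /eqP->; rewrite normrN -leNgt ler_norm.
have shift_inj : injective (fun v : 'rV[R]_d => v + s *: delta_mx 0 0) by exact: addIr.
have [||||phi [rphi _] phiE] := continuous_reach_interpolation all_shears_rich
    (xs := fun i => xs i + s *: delta_mx 0 0) (ys := fun i => ys i + s *: delta_mx 0 0).
- by move=> i j /shift_inj/xinj.
- by move=> i j /shift_inj/yinj.
- by move=> i; apply: shift_neq0; apply: le_lt_trans (s_gt i); rewrite lerDl.
- by move=> i; apply: shift_neq0; apply: le_lt_trans (s_gt i); rewrite lerDr.
exists ((fun x => x + - s *: delta_mx 0 0) \o phi \o (fun x => x + s *: delta_mx 0 0)).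
split=> [|i /=]; last by rewrite phiE scaleNr addrK.
have Fg : control_family all_shears system (shear (0 *: delta_mx 0 0) 0 0 0 0).
  by apply/all_shearsP; exists 0, 0, 0, 0, 0, 0; rewrite mxE.
apply: (reach_attainable _ Fg); apply: reach_comp; first exact: reach_translation.
by apply: reach_comp rphi _; exact: reach_translation.
Qed.

Lemma all_shears_measure_preserving S phi :
  attainable_on (control_family all_shears system) S phi ->
  exists2 Phi, {in S, phi =1 Phi} & measure_preserving Phi.
Proof.
elim=> {S phi} [g t S phi|g t S phi psi _ [Phi phiE mPhi]]
  /all_shearsP[i [c [u [c0 [b [r [ui ->]]]]]]] fl;
  have uw : dotr u (c *: delta_mx 0 i) = 0 by rewrite dotr_delta ui mulr0.
  exists (fun x => x + t *: shear (c *: delta_mx 0 i) u c0 b r x).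
    exact: (shear_flow_unique uw fl).
  exact: measure_preserving_shear.
exists ((fun x => x + t *: shear (c *: delta_mx 0 i) u c0 b r x) \o Phi).
  move=> x xS /=; rewrite -(phiE x xS).
  apply: (shear_flow_unique uw fl); rewrite inE; exists x => //.
  by rewrite -inE.
by apply: measure_preserving_comp mPhi _; exact: measure_preserving_shear.
Qed.

Lemma origin_fixing_fields_fix_origin S phi : S 0 ->
  attainable_on (control_family origin_fixing_fields system) S phi -> phi 0 = 0.
Proof.
have step g t (S' : set 'rV[R]_d) psi : S' 0 ->
    control_family origin_fixing_fields system g -> flow_on g t S' psi -> psi 0 = 0.
  move=> S0 /origin_fixing_fieldsP[[i [c [u [c0 [b [r [ui rb ->]]]]]]]|[h _ ->]] fl.
    have uw : dotr u (c *: delta_mx 0 i) = 0 by rewrite dotr_delta ui mulr0.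
    rewrite (shear_flow_unique uw fl) ?inE// /shear /ridge.
    have -> : dotr u 0 = 0 by rewrite /dotr big1// => j _; rewrite mxE mulr0.
    have m0 : Num.max 0 (r - `|b|) = 0 by apply/max_idPl; rewrite subr_le0.
    by rewrite mulr0 !add0r normrN m0 scale0r scaler0.
  exact: contraction_fixes_origin fl S0.
move=> + aphi; elim: aphi => [g t S1 psi Fg fl S0|g t S1 psi chi _ IH Fg fl S0].
  exact: step S0 Fg fl.
by rewrite /= IH//; apply: step Fg fl; exists 0 => //; exact: IH.
Qed.

End Systems.

Theorem theorem2p9 (R : realType) (d : nat) (p : R) :
  (2 <= d)%N -> 1 <= p ->
  (exists (l : nat) (Theta : set 'rV[R]_l)
          (f : 'rV[R]_d -> 'rV[R]_l -> 'rV[R]_d),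
      [/\ control_system Theta f,
          exact_universal_interpolation (control_family Theta f)
        & ~ universal_approximation_Lp p (control_family Theta f)])
  /\
  (exists (l : nat) (Theta : set 'rV[R]_l)
          (f : 'rV[R]_d -> 'rV[R]_l -> 'rV[R]_d),
      [/\ control_system Theta f,
          universal_approximation_Lp p (control_family Theta f)
        & ~ exact_universal_interpolation (control_family Theta f)]).
Proof.
case: d => [|[|n]]// _ p1; split.
  exists (n.+2 + (n.+2 + 4))%N, all_shears, system; split.
  - exact: control_system_system.
  - exact: all_shears_interpolation.
  - apply: measure_preserving_not_universal_approximation => // S phi.
    exact: all_shears_measure_preserving.
exists (n.+2 + (n.+2 + 4))%N, origin_fixing_fields, system; split.
- exact: control_system_system.
- apply: contraction_rich_universal_approximation => //.
    exact: origin_fixing_fields_rich.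
  by move=> h h0; apply/origin_fixing_fieldsP; right; exists h.
- move=> /(_ 1%N (fun=> 0) (fun=> delta_mx 0 0))[||phi [aphi /(_ 0)]].
  + by move=> i j _; rewrite !ord1.
  + by move=> i j _; rewrite !ord1.
  rewrite (origin_fixing_fields_fix_origin _ aphi); last by exists 0.
  by move=> /rowP/(_ 0)/eqP; rewrite !mxE !eqxx eq_sym oner_eq0.
Qed.
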